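(* Let $(S,\Sigma_S,\nu)$ and $(T,\Sigma_T,\eta)$ be standard measure spaces, and let $b\colon T\to[0,\nu(S)]$ and $c\colon S\to[0,\eta(T)]$ be Borel measurable. With $\mu=\nu\otimes\eta$, let $m_{S\times T}(b,c)$ be the supremum of $\mu(F)$ over all measurable sets $F\subseteq S\times T$ such that $\nu(F_t)\le b(t)$ for $\eta$-almost every $t\in T$ and $\eta(F^s)\le c(s)$ for $\nu$-almost every $s\in S$. Let $b^\downarrow\colon[0,\eta(T)]\to\mathbb R_{\ge0}$ be the nonincreasing rearrangement of $b$ with respect to $\eta$. Then $$m_{S\times T}(b,c)=\int_Tb\,d\eta-\max_{0\le a\le\eta(T)}\Big\{\int_0^ab^\downarrow(u)\,du-\int_S\min\{a,c(s)\}\,d\nu(s)\Big\}.$$ In particular, there exists a measurable set $F\subseteq S\times T$ with $\nu(F_t)=b(t)$ for $\eta$-almost every $t\in T$ and $\eta(F^s)=c(s)$ for $\nu$-almost every $s\in S$ if and only if $\int_Tb\,d\eta=\int_Sc\,d\nu$ and $$\int_0^ab^\downarrow(u)\,du-\int_S\min\{a,c(s)\}\,d\nu(s)\le0\quad\text{for every }a\in[0,\eta(T)].$$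
   Context: A standard measure space is a standard Borel space equipped with a finite atomless measure. For $X\subseteq S\times T$, the sections are $X_t=\{s\in S\mid(s,t)\in X\}$ for $t\in T$ and $X^s=\{t\in T\mid(s,t)\in X\}$ for $s\in S$. The nonincreasing rearrangement is $b^\downarrow(u)=\inf\{s\ge0\mid\eta(\{t\in T\mid b(t)>s\})\le u\}$. *)

(* Defs.v *)
From HB Require Import structures.
From mathcomp Require Import all_boot all_order all_algebra.
From mathcomp Require Import all_classical all_reals all_analysis.

Set Implicit Arguments.
Unset Strict Implicit.
Unset Printing Implicit Defensive.

Import Order.TTheory GRing.Theory Num.Theory.
Import numFieldNormedType.Exports.

Local Open Scope classical_set_scope.
Local Open Scope ring_scope.

(* Completeness is not written [cvg F] because that requires a pointed space. *)
Definition polish (R : realType) (X : metricType R) : Prop :=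
  (forall F : set_system X, ProperFilter F -> cauchy F -> exists x : X, F --> x) /\
  (exists2 D : set X, countable D & dense D).

(* [<<s open>>] is the Borel sigma-algebra of [X]; the last clause together
   with the bijectivity of [f] says that [f] is an isomorphism of measurable
   spaces. *)
Definition standard_borel (R : realType) (d : measure_display)
    (T : measurableType d) : Prop :=
  exists (X : metricType R) (f : T -> X),
    [/\ polish X, bijective f &
        forall B : set X, measurable (f @^-1` B) <-> <<s @open X >> B].

Definition atomless (R : realType) (d : measure_display)
    (T : measurableType d) (mu : {measure set T -> \bar R}) : Prop :=
  forall A : set T, measurable A -> (0 < mu A)%E ->
    exists B : set T, [/\ measurable B, B `<=` A & (0 < mu B < mu A)%E].

Definition standard_measure_space (R : realType) (d : measure_display)
    (T : measurableType d) (mu : {finite_measure set T -> \bar R}) : Prop :=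
  standard_borel R T /\ atomless mu.

(* [inf] is the real-valued infimum, which is junk on the empty set; the set
   below is nonempty as soon as [b] is bounded above and [0 <= u]. *)
Definition rearrangement (R : realType) (d : measure_display)
    (T : measurableType d) (eta : {measure set T -> \bar R}) (b : T -> R)
    (u : R) : R :=
  inf [set s : R | 0 <= s /\ (eta [set t | (s < b t)%R] <= u%:E)%E].

Definition max_measure (R : realType) (dS dT : measure_display)
    (S : measurableType dS) (T : measurableType dT)
    (nu : {finite_measure set S -> \bar R})
    (eta : {finite_measure set T -> \bar R})
    (b : T -> R) (c : S -> R) : \bar R :=
  ereal_sup [set ((nu \x eta) F)%E | F in [set F : set (S * T) |
    [/\ measurable F,
        {ae eta, forall t, (nu (ysection F t) <= (b t)%:E)%E} &
        {ae nu, forall s, (eta (xsection F s) <= (c s)%:E)%E}]]].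

Definition is_max (R : realType) (A : set (\bar R)) (M : \bar R) : Prop :=
  A M /\ ubound A M.

(* Main.v *)
Require Import Defs.
From HB Require Import structures.
From mathcomp Require Import all_boot all_order all_algebra.
From mathcomp Require Import all_classical all_reals all_analysis.
From mathcomp Require Import measurable_realfun.
From mathcomp Require Import ring lra.
Import Order.TTheory GRing.Theory Num.Theory.
Import numFieldNormedType.Exports.
Local Open Scope classical_set_scope.
Local Open Scope ring_scope.

Set Implicit Arguments.
Unset Strict Implicit.
Unset Printing Implicit Defensive.

(** Why the formula holds.  A feasible set F is a 0-1 flow in the complete
bipartite network between S and T, and the right-hand side is the value of a
minimal cut: leave uncut the capacities b(t) of a part of T of measure a.  This
is cheapest where b is largest; the rest of T then costs the integral of b minus
the integral of the rearrangement over [0, a], and each s pays min(a, c(s)).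

Weak duality ([weak_duality]).  For each a there is a weight phi on T with
values in [0, 1] and integral at most a whose integral against b is at least that
of the rearrangement over [0, a] ([rearrangement_weight]); splitting the mass of
F along phi and 1 - phi bounds it by the cut.  As phi may be fractional, level
sets of b of positive measure need no splitting.

Attainment ([strong_duality]).  First a density k with values in [0, 1] is
chosen to minimize the square distance between its marginals and (c, b).  Let p
and q be the residuals of the rows and columns.  The optimality condition is
that k = 1 where p + q > 0 and k = 0 where p + q < 0
([least_squares_density]).  Scaling down the overfull rows (p < 0) and columns
(q < 0) gives a feasible density.  Since k vanishes where p and q are both
nonpositive and one of them is negative, the scaled rows and columns become
exactly saturated, and the mass equals that of the cut given by p > 0 and q >= 0
([maximal_density]).

It remains to replace a density by a set with the same marginals
([set_of_density]).  Among the densities with these marginals, one maximizes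
the integral of x(s) y(t) k(s, t), where x and y are real coordinates on S and
T all of whose fibres are null; they exist because the spaces are standard and
atomless.  If k were not almost everywhere 0 or 1, mass could be exchanged
between the corners of rectangles inside { 0 < k < 1 }, which preserves the
marginals and strictly increases the objective ([swap_direction]).

Both minimizers come from [direct_method]: a convex L1-continuous functional on
densities attains its minimum, because nearly optimal densities of nearly
minimal L2 norm form a Cauchy sequence by the parallelogram identity.

Since the two inequalities meet at one pair (F, a), the maximum over a is
attained without any continuity argument; and if the integrals of b and c agree
and the maximum is at most 0, the mass of F is at least both integrals, which
forces the constraints to be equalities almost everywhere. *)

(** * Bounded measurable functions and their integrals *)

Section bounded_measurable.
Context {R : realType} {d} {X : measurableType d}.
Implicit Types f g : X -> R.

Definition bdmeas f := measurable_fun [set: X] f /\ exists M, forall x, `|f x| <= M.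

Lemma bdmeas_cst r : bdmeas (fun _ => r).
Proof. by split; [exact: measurable_cst | exists `|r|]. Qed.

Lemma bdmeasD f g : bdmeas f -> bdmeas g -> bdmeas (fun x => f x + g x).
Proof.
move=> [mf [M fM]] [mg [N gN]]; split; first exact: measurable_funD.
by exists (M + N) => x; rewrite (le_trans (ler_normD _ _))// lerD.
Qed.

Lemma bdmeasN f : bdmeas f -> bdmeas (fun x => - f x).
Proof.
move=> [mf [M fM]]; split; first exact: measurable_funN.
by exists M => x; rewrite normrN.
Qed.

Lemma bdmeasB f g : bdmeas f -> bdmeas g -> bdmeas (fun x => f x - g x).
Proof. by move=> bf bg; apply: bdmeasD => //; exact: bdmeasN. Qed.

Lemma bdmeasM f g : bdmeas f -> bdmeas g -> bdmeas (fun x => f x * g x).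
Proof.
move=> [mf [M fM]] [mg [N gN]]; split; first exact: measurable_funM.
by exists (M * N) => x; rewrite normrM ler_pM.
Qed.

Lemma bdmeasX f n : bdmeas f -> bdmeas (fun x => f x ^+ n).
Proof.
move=> [mf [M fM]]; split; first exact: measurable_funX.
by exists (M ^+ n) => x; rewrite normrX lerXn2r// nnegrE// (le_trans _ (fM x)).
Qed.

Lemma bdmeas_norm f : bdmeas f -> bdmeas (fun x => `|f x|).
Proof.
move=> [mf [M fM]]; split; first exact: measurableT_comp.
by exists M => x; rewrite normr_id.
Qed.

Lemma bdmeas_min f g : bdmeas f -> bdmeas g -> bdmeas (fun x => Num.min (f x) (g x)).
Proof.
move=> [mf [M fM]] [mg [N gN]]; split; first exact: measurable_minr.
exists (Num.max M N) => x; rewrite le_max /Num.min; case: ifP => _; first by rewrite fM.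
by rewrite gN orbT.
Qed.

Lemma bdmeas_indic (A : set X) : measurable A ->
  bdmeas (\1_A : X -> R).
Proof.
move=> mA; split; first exact: measurable_indic.
by exists 1 => x; rewrite indicE; case: (_ \in _); rewrite ?normr0 ?normr1.
Qed.

Lemma bdmeas_comp {d'} {Y : measurableType d'} (h : Y -> R) (u : X -> Y) :
  measurable_fun [set: X] u -> (measurable_fun [set: Y] h /\ exists M, forall x, `|h x| <= M) ->
  bdmeas (fun x => h (u x)).
Proof.
move=> mu [mh [M hM]]; split; first exact: measurableT_comp.
by exists M => x.
Qed.

Lemma bdmeas_integrable (m : {finite_measure set X -> \bar R}) f :
  bdmeas f -> m.-integrable setT (EFin \o f).
Proof.
move=> [mf [M fM]]; apply: measurable_bounded_integrable => //.
  by rewrite ltey_eq fin_num_measure.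
rewrite /bounded_near; exists M; split; first exact: num_real.
by move=> K MK x _ /=; rewrite (le_trans (fM x))// ltW.
Qed.

End bounded_measurable.

Section Rint.
Context {R : realType} {d} {X : measurableType d}.
Variable m : {finite_measure set X -> \bar R}.
Implicit Types f g : X -> R.
Local Notation I f := (Rintegral m setT f).

Lemma RintD f g : bdmeas f -> bdmeas g -> I (fun x => f x + g x) = I f + I g.
Proof. by move=> bf bg; rewrite RintegralD//; exact: bdmeas_integrable. Qed.

Lemma RintB f g : bdmeas f -> bdmeas g -> I (fun x => f x - g x) = I f - I g.
Proof. by move=> bf bg; rewrite RintegralB//; exact: bdmeas_integrable. Qed.

Lemma RintZl r f : bdmeas f -> I (fun x => r * f x) = r * I f.
Proof. by move=> bf; rewrite RintegralZl//; exact: bdmeas_integrable. Qed.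

Lemma RintZr r f : bdmeas f -> I (fun x => f x * r) = I f * r.
Proof. by move=> bf; rewrite RintegralZr//; exact: bdmeas_integrable. Qed.

Lemma RintN f : bdmeas f -> I (fun x => - f x) = - I f.
Proof.
by move=> bf; rewrite -mulN1r -RintZl//; apply: eq_Rintegral => x _; rewrite mulN1r.
Qed.

Lemma le_Rint f g : bdmeas f -> bdmeas g -> (forall x, f x <= g x) -> I f <= I g.
Proof. by move=> bf bg fg; apply: le_Rintegral => //; exact: bdmeas_integrable. Qed.

Lemma eq_Rint f g : f =1 g -> I f = I g.
Proof. by move=> fg; apply: eq_Rintegral => x _. Qed.

Lemma Rint_ge0 f : (forall x, 0 <= f x) -> 0 <= I f.
Proof. by move=> f0; apply: Rintegral_ge0. Qed.

Lemma le_norm_Rint f : bdmeas f -> `|I f| <= I (fun x => `|f x|).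
Proof. by move=> bf; apply: le_normr_Rintegral => //; exact: bdmeas_integrable. Qed.

Lemma Rint_cst r : I (fun _ => r) = r * fine (m setT).
Proof. exact: Rintegral_cst. Qed.

Lemma EFin_Rint f : bdmeas f -> (I f)%:E = (\int[m]_x (f x)%:E)%E.
Proof.
move=> bf; rewrite /Rintegral fineK//.
exact: integrable_fin_num (bdmeas_integrable m bf).
Qed.

Lemma Rint_indicM (A : set X) : measurable A -> I \1_A = fine (m A).
Proof. by move=> mA; rewrite /Rintegral integral_indic// setIT. Qed.

End Rint.

Section almost_everywhere.
Context {R : realType} {d} {X : measurableType d}.
Variable m : {finite_measure set X -> \bar R}.
Implicit Types f g : X -> R.

Lemma Rint_eq0_ae f : bdmeas f -> (forall x, 0 <= f x) -> \int[m]_x f x = 0 ->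
  {ae m, forall x, f x = 0}.
Proof.
move=> bf f0 If0.
have : {ae m, forall x, [set: X] x -> (EFin \o f) x = (cst 0%E) x}.
  apply/(ae_eq_integral_abs m measurableT).
    by apply/measurable_EFinP; exact: bf.1.
  transitivity (\int[m]_x f x)%:E; last by rewrite If0.
  by rewrite EFin_Rint//; apply: eq_integral => x _ /=; rewrite ger0_norm.
by apply: filterS => x /(_ Logic.I) [].
Qed.

Lemma ae_eq_Rint f g : bdmeas f -> bdmeas g -> {ae m, forall x, f x = g x} ->
  \int[m]_x f x = \int[m]_x g x.
Proof.
move=> bf bg fg; rewrite /Rintegral; congr fine.
apply: ae_eq_integral => //; 
  [by apply/measurable_EFinP; exact: bf.1|by apply/measurable_EFinP; exact: bg.1|].
by apply: filterS fg => x -> _.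
Qed.

(** The form in which almost everywhere statements are used below: a pointwise
implication between zero sets, valid off a null set, passes to integrals. *)
Lemma Rint_eq0_transfer f g (Z : set X) : bdmeas f -> bdmeas g ->
  (forall x, 0 <= f x) -> \int[m]_x f x = 0 -> measurable Z -> m Z = 0%E ->
  (forall x, ~ Z x -> f x = 0 -> g x = 0) -> \int[m]_x g x = 0.
Proof.
move=> bf bg f0 If0 mZ Z0 fg.
have aeZ : {ae m, forall x, ~ Z x}.
  by exists Z; split => // x /=; exact: contrapT.
rewrite (@ae_eq_Rint g (fun _ => 0)) ?Rint_cst ?mul0r//; first exact: bdmeas_cst.
by apply: filterS2 (Rint_eq0_ae bf f0 If0) aeZ => x fx nZx; exact: fg.
Qed.

Lemma ae_le_Rint f g : bdmeas f -> bdmeas g -> {ae m, forall x, f x <= g x} ->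
  \int[m]_x f x <= \int[m]_x g x.
Proof.
move=> bf bg fg.
rewrite (@ae_eq_Rint f (fun x => Num.min (f x) (g x)))//; last 2 first.
- exact: bdmeas_min.
- by apply: filterS fg => x fgx; rewrite min_l.
apply: le_Rint => //; first exact: bdmeas_min.
by move=> x; rewrite ge_min lexx orbT.
Qed.

(** Equality in an integrated inequality forces pointwise equality; this turns
saturated total mass into exact marginals. *)
Lemma ae_eq_of_Rint_le f g : bdmeas f -> bdmeas g -> {ae m, forall x, f x <= g x} ->
  \int[m]_x g x <= \int[m]_x f x -> {ae m, forall x, f x = g x}.
Proof.
move=> bf bg fg gf.
have b1 := bdmeasB bg bf; have b2 := bdmeas_norm b1.
have : \int[m]_x `|g x - f x| = 0.
  apply/eqP; rewrite eq_le Rint_ge0// andbT.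
  rewrite (@ae_eq_Rint _ (fun x => g x - f x))// ?RintB ?subr_le0//.
  by apply: filterS fg => x fgx; rewrite ger0_norm// subr_ge0.
move=> /(Rint_eq0_ae b2 (fun=> normr_ge0 _)).
by apply: filterS => x /normr0_eq0/eqP; rewrite subr_eq0 => /eqP.
Qed.

End almost_everywhere.

Section product_finite.
Context {R : realType} {d1 d2} {X : measurableType d1} {Y : measurableType d2}.
Variables (m1 : {finite_measure set X -> \bar R}) (m2 : {finite_measure set Y -> \bar R}).
Implicit Types F : X * Y -> R.

Let prod_finite : fin_num_fun (m1 \x m2)%E.
Proof.
apply: lty_fin_num_fun; rewrite -setXTT.
have /= -> := product_measure1E m1 m2 measurableT measurableT.
by rewrite lte_mul_pinfty// ?fin_num_measure// ltey_eq fin_num_measure.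
Qed.

(** The product measure under a name of its own.  The instances already attached
to [product_measure1] make it a finite measure only for factors of total mass at
most one. *)
Definition finprod : set (X * Y)%type -> \bar R := (m1 \x m2)%E.

HB.instance Definition _ := Measure.on finprod.
HB.instance Definition _ := Measure_isFinite.Build _ _ _ finprod prod_finite.

Lemma bdmeas_pair2 F x : bdmeas F -> bdmeas (fun y => F (x, y)).
Proof. by move=> bF; apply: bdmeas_comp => //; exact: pair1_measurable. Qed.

Lemma bdmeas_pair1 F y : bdmeas F -> bdmeas (fun x => F (x, y)).
Proof. by move=> bF; apply: bdmeas_comp => //; exact: pair2_measurable. Qed.

Lemma bdmeas_Rint2 F : bdmeas F -> bdmeas (fun x => \int[m2]_y F (x, y)).
Proof.
move=> bF; split.
  have := measurable_fubini_F (bdmeas_integrable finprod bF).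
  move=> mF; apply/measurable_EFinP.
  apply: eq_measurable_fun mF => x _ /=.
  by rewrite EFin_Rint//; exact: bdmeas_pair2.
have [_ [M FM]] := bF; exists (M * fine (m2 setT)) => x.
rewrite (le_trans (le_norm_Rint _ (bdmeas_pair2 x bF)))//.
rewrite -Rint_cst; apply: le_Rint => //; last exact: bdmeas_cst.
exact/bdmeas_norm/bdmeas_pair2.
Qed.

Lemma bdmeas_Rint1 F : bdmeas F -> bdmeas (fun y => \int[m1]_x F (x, y)).
Proof.
move=> bF; split.
  have := measurable_fubini_G (bdmeas_integrable finprod bF).
  move=> mF; apply/measurable_EFinP.
  apply: eq_measurable_fun mF => x _ /=.
  by rewrite EFin_Rint//; exact: bdmeas_pair1.
have [_ [M FM]] := bF; exists (M * fine (m1 setT)) => y.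
rewrite (le_trans (le_norm_Rint _ (bdmeas_pair1 y bF)))//.
rewrite -Rint_cst; apply: le_Rint => //; last exact: bdmeas_cst.
exact/bdmeas_norm/bdmeas_pair1.
Qed.

Lemma Rint_prod F : bdmeas F ->
  \int[finprod]_z F z = \int[m1]_x \int[m2]_y F (x, y).
Proof.
move=> bF; apply: EFin_inj; rewrite !EFin_Rint//; last exact: bdmeas_Rint2.
rewrite -(integral12_prod_meas1 (bdmeas_integrable finprod bF)).
apply: eq_integral => x _; rewrite EFin_Rint//; exact: bdmeas_pair2.
Qed.

Lemma Rint_swap F : bdmeas F ->
  \int[m1]_x \int[m2]_y F (x, y) = \int[m2]_y \int[m1]_x F (x, y).
Proof.
move=> bF; apply: EFin_inj.
rewrite !EFin_Rint//; [|exact: bdmeas_Rint1|exact: bdmeas_Rint2].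
transitivity (\int[m1]_x \int[m2]_y (F (x, y))%:E)%E.
  by apply: eq_integral => x _; rewrite EFin_Rint//; exact: bdmeas_pair2.
rewrite (Fubini (bdmeas_integrable finprod bF)).
by apply: eq_integral => y _; rewrite EFin_Rint//; exact: bdmeas_pair1.
Qed.

End product_finite.

(** * Minimizing convex functionals of densities *)

Section L1_complete.
Context {R : realType} {d} {X : measurableType d}.
Variable m : {finite_measure set X -> \bar R}.

Lemma cvg_of_abs_telescope (u : R^nat) (B : R) :
  (forall n, \sum_(0 <= i < n) `|u i.+1 - u i| <= B) -> cvgn u.
Proof.
move=> uB.
have cs : cvgn (series (telescope u)).
  apply: normed_cvg; apply: nondecreasing_is_cvgn.
    by apply: nondecreasing_series => i _ _; exact: normr_ge0.
  by exists B => _ [n _ <-]; exact: uB.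
rewrite (_ : u = (fun n => u 0%N + series (telescope u) n)).
  by apply: is_cvgD => //; exact: is_cvg_cst.
by apply/funext => n; rewrite -eq_sum_telescope.
Qed.

(** The increments are summable in L1, so the series of their absolute values is
finite almost everywhere and [g] converges there; as all values lie in [0, 1],
dominated convergence upgrades this to L1.  The upper limit, truncated to
[0, 1], serves as a limit defined everywhere. *)
Lemma L1_complete (g : nat -> X -> R) (K : R) :
  (forall n, measurable_fun setT (g n)) -> (forall n x, 0 <= g n x <= 1) ->
  (forall n, \int[m]_x `|g n.+1 x - g n x| <= K * 2^-1 ^+ n) ->
  exists h : X -> R, [/\ measurable_fun setT h, forall x, 0 <= h x <= 1 &
    \int[m]_x `|g n x - h x| @[n --> \oo] --> (0 : R)].
Proof.
move=> mg g01 gK.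
have bg n : bdmeas (g n).
  by split=> //; exists 1 => x; rewrite ger0_norm; have /andP[] := g01 n x.
pose h x := Num.max 0 (Num.min 1 (limn_sup (g ^~ x))).
have mh : measurable_fun setT h.
  apply: measurable_maxr => //; apply: measurable_minr => //.
  apply: measurable_fun_limn_sup => // x _.
    by exists 1 => _ [n _ <-]; have /andP[] := g01 n x.
  by exists 0 => _ [n _ <-]; have /andP[] := g01 n x.
have h01 x : 0 <= h x <= 1.
  by rewrite /h le_max lexx ge_max ler01 ge_min lexx.
exists h; split=> //.
have K0 : 0 <= K.
  by have := gK 0%N; rewrite expr0 mulr1; apply: le_trans; apply: Rintegral_ge0.
pose v n x := (`|g n.+1 x - g n x|%:E : \bar R).
have bv n : bdmeas (fun x => `|g n.+1 x - g n x|) by exact/bdmeas_norm/bdmeasB.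
have mv n : measurable_fun setT (v n) by apply/measurable_EFinP; exact: (bv n).1.
have v0 n x : (0 <= v n x)%E by rewrite lee_fin.
have ssum : (\sum_(n <oo) \int[m]_x v n x <= (K * 2)%:E)%E.
  apply: lime_le.
    by apply: is_cvg_nneseries => n _ _; apply: integral_ge0.
  apply: nearW => n /=.
  apply: (@le_trans _ _ (\sum_(0 <= i < n) K * 2^-1 ^+ i)%:E).
    by rewrite -sumEFin; apply: lee_sum => i _; rewrite -EFin_Rint// lee_fin gK.
  rewrite lee_fin -mulr_sumr ler_wpM2l//.
  have -> : \sum_(0 <= i < n) (2^-1 : R) ^+ i = 2 - 2 * 2^-1 ^+ n.
    elim: n => [|n IH]; first by rewrite big_geq// expr0; lra.
    by rewrite big_nat_recr//= IH exprS; lra.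
  by have : 0 <= (2^-1 : R) ^+ n by []; lra.
have isum : m.-integrable setT (fun x => \sum_(n <oo) v n x)%E.
  apply/integrableP; split.
    by apply: ge0_emeasurable_sum => // k x _ _; exact: v0.
  under eq_integral do rewrite gee0_abs ?nneseries_ge0//.
  by rewrite integral_nneseries//; exact: (le_lt_trans ssum (ltry _)).
have aecvg : {ae m, forall x, [set: X] x -> g n x @[n --> \oo] --> h x}.
  apply: filterS (integrable_ae measurableT isum) => x /(_ Logic.I) fx _.
  have cx : cvgn (g ^~ x).
    apply: (@cvg_of_abs_telescope _ (fine (\sum_(n <oo) v n x)%E)) => n.
    rewrite -lee_fin fineK// -sumEFin.
    by apply: nneseries_lim_ge => i _.
  have lx : limn (g ^~ x) = h x.
    rewrite /h cvg_limn_supE//.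
    have l1 : limn (g ^~ x) <= 1.
      by apply: limr_le => //; apply: nearW => n; have /andP[] := g01 n x.
    have l0 : 0 <= limn (g ^~ x).
      by apply: limr_ge => //; apply: nearW => n; have /andP[] := g01 n x.
    by rewrite min_r// max_r.
  by rewrite -lx.
have bh : bdmeas h.
  by split=> //; exists 1 => x; rewrite ger0_norm; have /andP[] := h01 x.
suff [_ _ c] : [/\ m.-integrable setT (cst 0%E),
    [sequence \int[m]_x `| `|g n x - h x|%:E - cst 0 x |]_n @ \oo --> 0 &
    [sequence \int[m]_x (`|g n x - h x|%:E)]_n @ \oo --> \int[m]_x (cst 0 x)]%E.
  by move: c; rewrite integral0 => c; exact: (fine_cvg c).
apply: (@dominated_convergence _ X R m setT measurableT
  (fun n x => `|g n x - h x|%:E) (cst 0%E) (cst 1%E)).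
- by move=> n; apply/measurable_EFinP; exact: (bdmeas_norm (bdmeasB (bg n) bh)).1.
- exact: measurable_cst.
- apply: filterS aecvg => x /(_ Logic.I) gx _.
  apply/cvg_EFin; first by apply: nearW.
  rewrite -(@normr0 _ R); apply: cvg_norm.
  by rewrite -(subrr (h x)); apply: cvgB => //; exact: cvg_cst.
- exact: (bdmeas_integrable m (bdmeas_cst 1)).
- apply: nearW => x n _; rewrite lee_fin normr_id ler_norml.
  by have := g01 n x; have := h01 x; move=> /andP[? ?] /andP[? ?]; lra.
Qed.
End L1_complete.

Section direct_method.
Context {R : realType} {d} {X : measurableType d}.
Variable m : {finite_measure set X -> \bar R}.
Implicit Types f g : X -> R.

(** A fractional subset of [X]: the relaxation of an indicator function. *)
Definition density f := measurable_fun setT f /\ forall x, 0 <= f x <= 1.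

Lemma density_bdmeas f : density f -> bdmeas f.
Proof.
by move=> [mf f01]; split=> //; exists 1 => x; rewrite ger0_norm; have /andP[] := f01 x.
Qed.

Definition midpoint f g : X -> R := fun x => (f x + g x) / 2.

Lemma density_midpoint f g : density f -> density g -> density (midpoint f g).
Proof.
move=> df dg; split.
  by have [] := bdmeasM (bdmeasD (density_bdmeas df) (density_bdmeas dg)) (bdmeas_cst 2^-1).
by move=> x; have /andP[? ?] := df.2 x; have /andP[? ?] := dg.2 x; rewrite /midpoint; lra.
Qed.

Definition midconvex (Phi : (X -> R) -> R) := forall f g, density f -> density g ->
  Phi (midpoint f g) <= (Phi f + Phi g) / 2.

Definition L1lipschitz (Phi : (X -> R) -> R) := exists2 K, 0 <= K &
  forall f g, density f -> density g -> `|Phi f - Phi g| <= K * \int[m]_x `|f x - g x|.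

Lemma le_cvg_cst (u : R^nat) (l r : R) :
  (forall n, r <= u n) -> u n @[n --> \oo] --> l -> r <= l.
Proof.
move=> ru ul; rewrite -(cvg_lim (@Rhausdorff R) ul); apply: limr_ge.
  by apply/cvg_ex; exists l.
exact: nearW.
Qed.

Lemma Rint_parallelogram f g : density f -> density g ->
  \int[m]_x (f x - g x) ^+ 2 =
  2 * (\int[m]_x f x ^+ 2) + 2 * (\int[m]_x g x ^+ 2)
    - 4 * (\int[m]_x midpoint f g x ^+ 2).
Proof.
move=> df dg.
have bf := density_bdmeas df; have bg := density_bdmeas dg.
have bm := density_bdmeas (density_midpoint df dg).
have bs u : bdmeas u -> bdmeas (fun x : X => u x ^+ 2 : R) by move=> bu; exact: bdmeasX.
have bz r (u : X -> R) : bdmeas u -> bdmeas (fun x => r * u x).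
  by move=> bu; apply: bdmeasM => //; exact: bdmeas_cst.
rewrite -!RintZl -?RintD -?RintB; try by do ?[apply: bs|apply: bz|apply: bdmeasD].
by apply: eq_Rint => x; rewrite /midpoint; field.
Qed.

(** Young's inequality; with [t] adapted to the size of the L2 norm it converts
a geometric L2 bound into a geometric L1 bound. *)
Lemma Rint_abs_le_sq (f : X -> R) (t : R) : 0 < t -> bdmeas f ->
  \int[m]_x `|f x| <= (t * fine (m setT) + t^-1 * \int[m]_x f x ^+ 2) / 2.
Proof.
move=> t0 bf.
have bs := bdmeasX 2 bf.
rewrite -Rint_cst -RintZl// -RintD//;
  [|exact: bdmeas_cst|by apply: bdmeasM => //; exact: bdmeas_cst].
have bt : bdmeas (fun x => t + t^-1 * f x ^+ 2).
  by apply: bdmeasD; [exact: bdmeas_cst|apply: bdmeasM => //; exact: bdmeas_cst].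
rewrite -RintZr//; apply: le_Rint.
- exact: bdmeas_norm.
- by apply: bdmeasM => //; exact: bdmeas_cst.
move=> x; rewrite ler_pdivlMr// -subr_ge0 -[f x ^+ 2]real_normK ?num_real//.
have -> : t + t^-1 * `|f x| ^+ 2 - `|f x| * 2 = t^-1 * (t - `|f x|) ^+ 2.
  by field; rewrite gt_eqF.
by rewrite mulr_ge0 ?invr_ge0 ?sqr_ge0// ltW.
Qed.

Variables Psi Phi : (X -> R) -> R.
Hypotheses (cPsi : midconvex Psi) (cPhi : midconvex Phi).
Hypotheses (lPsi : L1lipschitz Psi) (lPhi : L1lipschitz Phi).
Hypothesis Phi_lb : exists B, forall f, density f -> B <= Phi f.

(** Strong convergence takes the place of weak compactness.  Among densities that
are optimal up to [1/n], take one whose L2 norm is close to the least possible.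
These least norms increase with [n] to a limit [D], and the midpoint of two such
densities is again nearly optimal, so its norm is not much below [D]; the
parallelogram identity then makes the densities close to each other. *)
Theorem direct_method f0 : density f0 -> Psi f0 <= 0 ->
  exists k, [/\ density k, Psi k <= 0 &
    forall f, density f -> Psi f <= 0 -> Phi k <= Phi f].
Proof.
move=> df0 Pf0.
pose C := [set f | density f /\ Psi f <= 0].
have Cmid f g : C f -> C g -> C (midpoint f g).
  move=> [df Pf] [dg Pg]; split; first exact: density_midpoint.
  by have := cPsi df dg; lra.
have [B PhiB] := Phi_lb.
have hiC : has_inf (Phi @` C).
  split; first by exists (Phi f0), f0.
  by exists B => _ [f [df _] <-]; exact: PhiB.
pose i := inf (Phi @` C).
pose A n := [set f | C f /\ Phi f <= i + n.+1%:R^-1].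
have A_mono n p : (n <= p)%N -> A p `<=` A n.
  move=> np f [Cf Pf]; split=> //; apply: (le_trans Pf).
  by rewrite lerD2l lef_pV2 ?posrE// ler_nat ltnS.
have Amid n f g : A n f -> A n g -> A n (midpoint f g).
  move=> [Cf Pf] [Cg Pg]; split; first exact: Cmid.
  have := @cPhi f g (proj1 Cf) (proj1 Cg).
  rewrite /= in Pf Pg *; move: Pf Pg; set r := i + _.
  lra.
have A0 n : A n !=set0.
  have [|_ [f Cf <-] Pf] := @inf_adherent _ _ n.+1%:R^-1 _ hiC.
    by rewrite invr_gt0.
  by exists f; split=> //; exact: ltW.
pose N f := \int[m]_x f x ^+ 2.
pose M := fine (m setT).
have M0 : 0 <= M by apply: fine_ge0.
have N0 f : 0 <= N f by apply: Rint_ge0 => x; exact: sqr_ge0.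
have NM f : density f -> N f <= M.
  move=> df; rewrite -[M]mul1r -Rint_cst; apply: le_Rint.
  - exact/bdmeasX/density_bdmeas.
  - exact: bdmeas_cst.
  by move=> x; have /andP[? ?] := df.2 x; rewrite expr_le1.
have hiA n : has_inf (N @` A n).
  split; first by have [f Af] := A0 n; exists (N f), f.
  by exists 0 => _ [f _ <-].
pose dn n := inf (N @` A n).
have dnle n f : A n f -> dn n <= N f.
  by move=> Af; apply: ge_inf; [exact: (hiA n).2|exists f].
have dnM n : dn n <= M.
  have [f Af] := A0 n; apply: (le_trans (dnle n f Af)); apply: NM; exact: Af.1.1.
have hsd : has_sup (range dn).
  by split; [exists (dn 0%N), 0%N|exists M => _ [n _ <-]].
pose D := sup (range dn).
have dnD n : dn n <= D by apply: ub_le_sup; [exact: hsd.2|exists n].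
have dn_mono n p : (n <= p)%N -> dn n <= dn p.
  move=> np; apply: lb_le_inf; first exact: (hiA p).1.
  by move=> _ [f Af <-]; apply: dnle; exact: A_mono Af.
(* The parallelogram identity multiplies [e j] by 8, and the squared L2 distances
   have to decay like [4 ^ - j]. *)
pose e (j : nat) : R := (2^-1 ^+ j) ^+ 2 / 8.
have e0 j : 0 < e j by rewrite /e divr_gt0// exprn_gt0// exprn_gt0// invr_gt0.
(* [j <= p.1] makes the limit optimal; the lower bound on the norms over the
   whole of [A p.1] applies to midpoints. *)
have near_opt j : exists p : nat * (X -> R), [/\ (j <= p.1)%N, A p.1 p.2,
    N p.2 <= D + e j & forall f, A p.1 f -> D - e j <= N f].
  have [_ [n _ <-] Dn] := sup_adherent (e0 j) hsd.
  pose n' := maxn j n.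
  have [_ [g Ag <-] gN] := inf_adherent (e0 j) (hiA n').
  exists (n', g); split => //=; first exact: leq_maxl.
    by apply: (le_trans (ltW gN)); rewrite lerD2r; exact: dnD.
  move=> f Af; apply: le_trans (dnle _ _ Af); apply: (le_trans (ltW Dn)).
  by apply: dn_mono; exact: leq_maxr.
have {near_opt}[G GP] := choice near_opt.
pose n j := (G j).1; pose g j := (G j).2.
have dg j : density (g j) by have [_ [[]]] := GP j.
have e_dec j : e j.+1 <= e j.
  rewrite /e ler_wpM2r// lerXn2r ?nnegrE ?exprn_ge0 ?invr_ge0//.
  by rewrite exprS; have : 0 <= (2^-1 : R) ^+ j by []; lra.
(* The midpoint lies in the larger of the two consecutive sets [A]. *)
have sq j : \int[m]_x (g j.+1 x - g j x) ^+ 2 <= (2^-1 ^+ j) ^+ 2.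
  rewrite Rint_parallelogram//.
  have [_ A1 N1 L1] := GP j; have [_ A2 N2 L2] := GP j.+1.
  rewrite -/(g j) in A1 N1; rewrite -/(g j.+1) in A2 N2.
  have Nmid : D - e j <= N (midpoint (g j.+1) (g j)).
    have [nn|/ltnW nn] := leqP (n j) (n j.+1).
      by apply: L1; apply: Amid => //; exact: A_mono A2.
    apply: (@le_trans _ _ (D - e j.+1)); first by have := e_dec j; lra.
    by apply: L2; apply: Amid => //; exact: A_mono A1.
  have := e_dec j; move: N1 N2 Nmid; rewrite /N.
  suff -> : (2^-1 ^+ j) ^+ 2 = 8 * e j by lra.
  by rewrite /e mulrC divfK// pnatr_eq0.
have L1 j : \int[m]_x `|g j.+1 x - g j x| <= ((M + 1) / 2) * 2^-1 ^+ j.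
  have t0 : 0 < (2^-1 : R) ^+ j by rewrite exprn_gt0// invr_gt0.
  have := Rint_abs_le_sq t0 (bdmeasB (density_bdmeas (dg j.+1)) (density_bdmeas (dg j))).
  have : (2^-1 ^+ j)^-1 * \int[m]_x (g j.+1 x - g j x) ^+ 2 <= 2^-1 ^+ j.
    by rewrite ler_pdivrMl// -expr2 sq.
  by rewrite -/M; set t := 2^-1 ^+ j; lra.
have [k [mk k01 gk]] := L1_complete (fun j => (dg j).1) (fun j => (dg j).2) L1.
have dk : density k by [].
exists k; split => //.
  have [K K0 lip] := lPsi.
  apply: (@le_cvg_cst (fun j => K * \int[m]_x `|g j x - k x|)).
    move=> j; have [_ [[_ Pg]] _ _ _] := GP j.
    by have := lip _ _ (dg j) dk; rewrite ler_norml => /andP[+ _]; rewrite /g; lra.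
  by rewrite -(mulr0 K); apply: cvgMl_tmp; exact: gk.
move=> f df Pf.
have iPhi : i <= Phi f by apply: ge_inf; [exact: hiC.2|exists f].
apply: le_trans iPhi.
have [K K0 lip] := lPhi.
apply: (@le_cvg_cst (fun j => i + j.+1%:R^-1 + K * \int[m]_x `|g j x - k x|)).
  move=> j; have [nj [_ Pg] _ _] := GP j.
  have := lip _ _ (dg j) dk; rewrite ler_norml => /andP[+ _].
  have : (n j).+1%:R^-1 <= (j.+1%:R^-1 : R).
    by rewrite lef_pV2 ?posrE// ler_nat ltnS.
  move: Pg; rewrite /g /n; set r := _.+1%:R^-1; set r' := _.+1%:R^-1.
  by rewrite /=; lra.
rewrite -[X in _ --> X]addr0 -[X in _ --> X + _]addr0; apply: cvgD; last first.
  by rewrite -(mulr0 K); apply: cvgMl_tmp; exact: gk.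
apply: cvgD; first exact: cvg_cst.
exact: cvg_harmonic.
Qed.

End direct_method.

(** * Marginals of a density and least squares *)

Section marginals.
Context {R : realType} {dS dT} {S : measurableType dS} {T : measurableType dT}.
Variables (nu : {finite_measure set S -> \bar R}) (eta : {finite_measure set T -> \bar R}).
Implicit Types (k f g h : S * T -> R) (b : T -> R) (c : S -> R).

Definition row_marginal f s := \int[eta]_t f (s, t).
Definition col_marginal f t := \int[nu]_s f (s, t).

Definition misfit c b f : R :=
  \int[nu]_s (c s - row_marginal f s) ^+ 2 + \int[eta]_t (b t - col_marginal f t) ^+ 2.

Local Notation mu := (finprod nu eta).

Lemma bdmeas_row f : bdmeas f -> bdmeas (row_marginal f).
Proof. exact: bdmeas_Rint2. Qed.

Lemma bdmeas_col f : bdmeas f -> bdmeas (col_marginal f).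
Proof. exact: bdmeas_Rint1. Qed.

Lemma bdmeas_fst c : bdmeas c -> bdmeas (fun z : S * T => c z.1).
Proof. by move=> bc; apply: bdmeas_comp => //; exact: measurable_fst. Qed.

Lemma bdmeas_snd b : bdmeas b -> bdmeas (fun z : S * T => b z.2).
Proof. by move=> bb; apply: bdmeas_comp => //; exact: measurable_snd. Qed.

Lemma row_marginalDZ f g r s : bdmeas f -> bdmeas g ->
  row_marginal (fun z => f z + r * g z) s = row_marginal f s + r * row_marginal g s.
Proof.
move=> bf bg; rewrite /row_marginal -RintZl ?RintD//; try exact: bdmeas_pair2.
by apply: bdmeasM; [exact: bdmeas_cst|exact: bdmeas_pair2].
Qed.

Lemma col_marginalDZ f g r t : bdmeas f -> bdmeas g ->
  col_marginal (fun z => f z + r * g z) t = col_marginal f t + r * col_marginal g t.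
Proof.
move=> bf bg; rewrite /col_marginal -RintZl ?RintD//; try exact: bdmeas_pair1.
by apply: bdmeasM; [exact: bdmeas_cst|exact: bdmeas_pair1].
Qed.

Lemma Rint_row f : bdmeas f -> \int[mu]_z f z = \int[nu]_s row_marginal f s.
Proof. exact: Rint_prod. Qed.

Lemma Rint_col f : bdmeas f -> \int[mu]_z f z = \int[eta]_t col_marginal f t.
Proof. by move=> bf; rewrite Rint_prod// Rint_swap. Qed.

Lemma Rint_rowM c f : bdmeas c -> bdmeas f ->
  \int[nu]_s (c s * row_marginal f s) = \int[mu]_z (c z.1 * f z).
Proof.
move=> bc bf; rewrite Rint_row; last by apply: bdmeasM => //; exact: bdmeas_fst.
apply: eq_Rint => s; rewrite -RintZl//; exact: bdmeas_pair2.
Qed.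

Lemma Rint_colM b f : bdmeas b -> bdmeas f ->
  \int[eta]_t (b t * col_marginal f t) = \int[mu]_z (b z.2 * f z).
Proof.
move=> bb bf; rewrite Rint_col; last by apply: bdmeasM => //; exact: bdmeas_snd.
apply: eq_Rint => t; rewrite -RintZl//; exact: bdmeas_pair1.
Qed.

Lemma misfit_ge0 c b f : 0 <= misfit c b f.
Proof. by rewrite addr_ge0//; apply: Rint_ge0 => x; exact: sqr_ge0. Qed.

Lemma Rint_sq_line {d} {X : measurableType d} (m : {finite_measure set X -> \bar R})
    (u v : X -> R) (r : R) : bdmeas u -> bdmeas v ->
  \int[m]_x (u x - r * v x) ^+ 2 =
  \int[m]_x u x ^+ 2 - 2 * r * (\int[m]_x (u x * v x)) + r ^+ 2 * \int[m]_x v x ^+ 2.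
Proof.
move=> bu bv.
have bu2 := bdmeasX 2 bu; have bv2 := bdmeasX 2 bv; have buv := bdmeasM bu bv.
have bz a (w : X -> R) : bdmeas w -> bdmeas (fun x => a * w x).
  by move=> bw; apply: bdmeasM => //; exact: bdmeas_cst.
rewrite -!RintZl// -RintB// -?RintD//; try by do ?[apply: bz|apply: bdmeasB].
by apply: eq_Rint => x; ring.
Qed.

Lemma misfit_line c b f h r : bdmeas c -> bdmeas b -> bdmeas f -> bdmeas h ->
  misfit c b (fun z => f z + r * h z) = misfit c b f
  - 2 * r * (\int[mu]_z ((c z.1 - row_marginal f z.1 + (b z.2 - col_marginal f z.2)) * h z))
  + r ^+ 2 * (\int[nu]_s row_marginal h s ^+ 2 + \int[eta]_t col_marginal h t ^+ 2).
Proof.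
move=> bc bb bf bh; rewrite /misfit.
have bp : bdmeas (fun s => c s - row_marginal f s) by apply: bdmeasB => //; exact: bdmeas_row.
have bq : bdmeas (fun t => b t - col_marginal f t) by apply: bdmeasB => //; exact: bdmeas_col.
have brh := bdmeas_row bh; have bch := bdmeas_col bh.
rewrite (@eq_Rint _ _ _ nu _
    (fun s => (c s - row_marginal f s - r * row_marginal h s) ^+ 2)); last first.
  by move=> s; rewrite row_marginalDZ// opprD addrA.
rewrite (@eq_Rint _ _ _ eta _
    (fun t => (b t - col_marginal f t - r * col_marginal h t) ^+ 2)); last first.
  by move=> t; rewrite col_marginalDZ// opprD addrA.
rewrite !Rint_sq_line// (Rint_rowM bp bh) (Rint_colM bq bh).
have -> : \int[mu]_z ((c z.1 - row_marginal f z.1 + (b z.2 - col_marginal f z.2)) * h z) =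
   \int[mu]_z ((c z.1 - row_marginal f z.1) * h z)
    + \int[mu]_z ((b z.2 - col_marginal f z.2) * h z).
  rewrite -RintD; first by apply: eq_Rint => z; ring.
    by apply: bdmeasM => //; exact: (bdmeas_fst bp).
  by apply: bdmeasM => //; exact: (bdmeas_snd bq).
ring.
Qed.

Lemma misfit_midconvex c b : bdmeas c -> bdmeas b -> midconvex (misfit c b).
Proof.
move=> bc bb f g /density_bdmeas bf /density_bdmeas bg.
have bh := bdmeasB bg bf.
have -> : midpoint f g = (fun z => f z + 2^-1 * (g z - f z)).
  by apply/funext => z; rewrite /midpoint; field.
have -> : misfit c b g = misfit c b (fun z => f z + 1 * (g z - f z)).
  by congr misfit; apply/funext => z; rewrite mul1r addrCA subrr addr0.
rewrite !misfit_line//.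
set P := Rintegral _ _ _; set Q := (\int[nu]_s row_marginal _ s ^+ 2 + _).
have Q0 : 0 <= Q by rewrite addr_ge0//; apply: Rint_ge0 => x; exact: sqr_ge0.
by move: (misfit c b f) => A; nra.
Qed.

Lemma Rint_sq_lip {d} {X : measurableType d} (m : {finite_measure set X -> \bar R})
    (w : X -> R) (L : R) : bdmeas w -> exists2 K, 0 <= K &
  forall u v, bdmeas u -> bdmeas v -> (forall x, `|u x| <= L) -> (forall x, `|v x| <= L) ->
   `|\int[m]_x (w x - u x) ^+ 2 - \int[m]_x (w x - v x) ^+ 2| <=
     K * \int[m]_x `|u x - v x|.
Proof.
move=> bw; have [_ [M wM]] := bw.
exists (2 * (`|M| + `|L|)); first by rewrite mulr_ge0// addr_ge0.
move=> u v bu bv uL vL.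
have bwu := bdmeasX 2 (bdmeasB bw bu); have bwv := bdmeasX 2 (bdmeasB bw bv).
have buv := bdmeas_norm (bdmeasB bu bv).
rewrite -RintB// (le_trans (le_norm_Rint _ (bdmeasB bwu bwv)))//.
rewrite -RintZl//; apply: le_Rint.
- exact/bdmeas_norm/bdmeasB.
- by apply: bdmeasM => //; exact: bdmeas_cst.
move=> x; rewrite (_ : _ - _ = (2 * w x - u x - v x) * (v x - u x)); last by ring.
rewrite normrM [`|v x - _|]distrC ler_wpM2r//.
have := wM x; have := uL x; have := vL x.
have := ler_norm M; have := ler_norm L.
have -> : 2 * w x = w x + w x by ring.
have := ler_normD (w x) (w x).
have := ler_normB (w x + w x) (u x); have := ler_normB (w x + w x - u x) (v x).
lra.
Qed.

Lemma density_row_le f s : density f -> `|row_marginal f s| <= fine (eta setT).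
Proof.
move=> df; have bf := bdmeas_pair2 s (density_bdmeas df).
rewrite (le_trans (le_norm_Rint _ bf))// -[leRHS]mul1r -Rint_cst; apply: le_Rint.
- exact: bdmeas_norm.
- exact: bdmeas_cst.
by move=> t; rewrite ger0_norm; have /andP[] := df.2 (s, t).
Qed.

Lemma density_col_le f t : density f -> `|col_marginal f t| <= fine (nu setT).
Proof.
move=> df; have bf := bdmeas_pair1 t (density_bdmeas df).
rewrite (le_trans (le_norm_Rint _ bf))// -[leRHS]mul1r -Rint_cst; apply: le_Rint.
- exact: bdmeas_norm.
- exact: bdmeas_cst.
by move=> s; rewrite ger0_norm; have /andP[] := df.2 (s, t).
Qed.

Lemma row_L1_contraction f g : bdmeas f -> bdmeas g ->
  \int[nu]_s `|row_marginal f s - row_marginal g s| <= \int[mu]_z `|f z - g z|.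
Proof.
move=> bf bg; have bfg := bdmeasB bf bg.
rewrite Rint_row; last exact: bdmeas_norm.
apply: le_Rint.
- by apply/bdmeas_norm/bdmeasB; exact: bdmeas_row.
- exact/bdmeas_row/bdmeas_norm.
move=> s; rewrite /row_marginal -RintB; try exact: bdmeas_pair2.
exact: (le_norm_Rint _ (bdmeas_pair2 s bfg)).
Qed.

Lemma col_L1_contraction f g : bdmeas f -> bdmeas g ->
  \int[eta]_t `|col_marginal f t - col_marginal g t| <= \int[mu]_z `|f z - g z|.
Proof.
move=> bf bg; have bfg := bdmeasB bf bg.
rewrite Rint_col; last exact: bdmeas_norm.
apply: le_Rint.
- by apply/bdmeas_norm/bdmeasB; exact: bdmeas_col.
- exact/bdmeas_col/bdmeas_norm.
move=> t; rewrite /col_marginal -RintB; try exact: bdmeas_pair1.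
exact: (le_norm_Rint _ (bdmeas_pair1 t bfg)).
Qed.

Lemma misfit_L1lipschitz c b : bdmeas c -> bdmeas b -> L1lipschitz mu (misfit c b).
Proof.
move=> bc bb.
have [K1 K10 h1] := Rint_sq_lip nu (fine (eta setT)) bc.
have [K2 K20 h2] := Rint_sq_lip eta (fine (nu setT)) bb.
exists (K1 + K2); first exact: addr_ge0.
move=> f g df dg; have bf := density_bdmeas df; have bg := density_bdmeas dg.
have l1 := h1 _ _ (bdmeas_row bf) (bdmeas_row bg)
  (fun s => density_row_le s df) (fun s => density_row_le s dg).
have l2 := h2 _ _ (bdmeas_col bf) (bdmeas_col bg)
  (fun s => density_col_le s df) (fun s => density_col_le s dg).
rewrite /misfit opprD addrACA (le_trans (ler_normD _ _))// mulrDl lerD//.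
  apply: (le_trans l1); apply: ler_wpM2l => //; exact: row_L1_contraction.
by apply: (le_trans l2); apply: ler_wpM2l => //; exact: col_L1_contraction.
Qed.

(** Only one-sided perturbations are available, so the first-order condition is
an inequality. *)
Lemma first_order_le0 (P Q : R) : 0 <= Q ->
  (forall r, 0 < r <= 1 -> 0 <= - (2 * r * P) + r ^+ 2 * Q) -> P <= 0.
Proof.
move=> Q0 h; rewrite leNgt; apply/negP => P0.
(* Any [r] in ]0, 1] with [r * Q < 2 * P] gives a contradiction. *)
pose r := P / (P + Q + 1).
have D0 : 0 < P + Q + 1 by lra.
have r0 : 0 < r by rewrite divr_gt0.
have r1 : r <= 1 by rewrite ler_pdivrMr//; lra.
have := h r; rewrite r0 r1 => /(_ isT).
have rD : r * (P + Q + 1) = P by rewrite divfK// gt_eqF.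
have : r * Q <= P by nra.
nra.
Qed.

(** The optimality condition is stated through test functions [g] that vanish
wherever [k] has the value dictated by the sign of the residual [e]; this is the
almost everywhere statement in integrated form.  It is obtained by moving from
[k] towards the density [k1] that has the dictated values. *)
Theorem least_squares_density c b : bdmeas c -> bdmeas b ->
  exists2 k : S * T -> R, density k & forall g, bdmeas g ->
    (forall z, let e := c z.1 - row_marginal k z.1 + (b z.2 - col_marginal k z.2) in
      (0 < e -> k z = 1) -> (e < 0 -> k z = 0) -> g z = 0) ->
    \int[mu]_z g z = 0.
Proof.
move=> bc bb.
have d0 : density (fun _ : S * T => 0 : R).
  by split; [exact: measurable_cst|move=> _; rewrite lexx ler01].
have [|||k [dk _ kmin]] := @direct_method R _ _ mu (fun _ => 0) (misfit c b) _
    (misfit_midconvex bc bb) _ (misfit_L1lipschitz bc bb) _ _ d0 (lexx _).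
- by move=> f g _ _; rewrite addr0 mul0r.
- by exists 0 => // f g _ _; rewrite subrr normr0 mul0r.
- by exists 0 => f _; exact: misfit_ge0.
exists k => // g bg g0.
have bk := density_bdmeas dk.
pose e (z : S * T) := c z.1 - row_marginal k z.1 + (b z.2 - col_marginal k z.2).
have be : bdmeas e.
  apply: bdmeasD.
    apply: (bdmeas_fst (c := fun s => c s - row_marginal k s)).
    by apply: bdmeasB => //; exact: bdmeas_row.
  apply: (bdmeas_snd (b := fun t => b t - col_marginal k t)).
  by apply: bdmeasB => //; exact: bdmeas_col.
pose k1 z := if 0 < e z then 1 else if e z < 0 then 0 else k z.
have dk1 : density k1.
  split.
    apply: measurable_fun_ifT => //.
      by apply: measurable_fun_ltr => //; exact: be.1.
    apply: measurable_fun_ifT => //; last exact: bk.1.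
    by apply: measurable_fun_ltr => //; exact: be.1.
  move=> z; rewrite /k1; case: ifP => _; first by rewrite ler01 lexx.
  by case: ifP => _; [rewrite lexx ler01|exact: dk.2].
have bk1 := density_bdmeas dk1.
have bh := bdmeasB bk1 bk.
have eh0 z : 0 <= e z * (k1 z - k z).
  rewrite /k1; have /andP[k0 kl1] := dk.2 z.
  case: ltP => e0; first by rewrite mulr_ge0 ?subr_ge0// ltW.
  case: ltP => e1; first by rewrite mulr_le0 ?subr_le0.
  by rewrite subrr mulr0.
have : \int[mu]_z (e z * (k1 z - k z)) <= 0.
  apply: (@first_order_le0 _ (\int[nu]_s row_marginal (fun z => k1 z - k z) s ^+ 2 +
     \int[eta]_t col_marginal (fun z => k1 z - k z) t ^+ 2)).
    by rewrite addr_ge0//; apply: Rint_ge0 => x; exact: sqr_ge0.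
  move=> r /andP[r0 r1].
  have dr : density (fun z => k z + r * (k1 z - k z)).
    split.
      by have [] := bdmeasD bk (bdmeasM (bdmeas_cst r) bh).
    by move=> z; have /andP[? ?] := dk.2 z; have /andP[? ?] := dk1.2 z; nra.
  have := kmin _ dr (lexx _); rewrite misfit_line//.
  by rewrite -addrA lerDl.
rewrite le_eqVlt ltNge Rint_ge0// orbF => /eqP int0.
apply: (Rint_eq0_transfer (m := mu) (f := fun z => e z * (k1 z - k z)) (Z := set0)) => //.
  exact: bdmeasM.
move=> z _ ez; apply: g0; rewrite -/(e z) => ez0; move: ez; rewrite /k1.
  rewrite ez0 => /eqP; rewrite mulf_eq0 gt_eqF//= subr_eq0 => /eqP <-//.
rewrite ez0 ltNge (ltW ez0)/= => /eqP; rewrite mulf_eq0 lt_eqF//= sub0r oppr_eq0.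
by move/eqP.
Qed.

End marginals.

(** * A feasible density of maximal mass *)

Section trimming.
Context {R : realType}.

(** The factor that brings a marginal [v] down to the capacity [u].  The power
-1 agrees with the inverse on the positive axis and is measurable everywhere. *)
Definition trim (u v : R) : R := if u < v then u * v `^ (-1) else 1.

Lemma trim_mul u v : 0 <= u -> 0 <= v -> trim u v * v = Num.min u v.
Proof.
move=> u0 v0; rewrite /trim /Num.min; case: ltP => uv; last by rewrite mul1r.
by rewrite powR_inv1// divfK// gt_eqF// (le_lt_trans u0).
Qed.

Lemma trim_bounds u v : 0 <= u -> 0 <= trim u v <= 1.
Proof.
move=> u0; rewrite /trim; case: ltP => uv; last by rewrite ler01 lexx.
have v0 := le_lt_trans u0 uv.
rewrite (powR_inv1 (ltW v0)) ler_pdivrMr// mul1r (ltW uv) andbT.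
by rewrite mulr_ge0 ?invr_ge0// ltW.
Qed.

(** The pointwise content of the minimal cut.  The three terms are the columns
with [b < l], the rectangle of the rows with [r < c] and the columns with
[l <= b], and the rows with [c <= r]; they overlap only where [k] is 0. *)
Lemma trim_split (k c r b l : R) :
  (0 < c - r + (b - l) -> k = 1) -> (c - r + (b - l) < 0 -> k = 0) ->
  k * trim c r * trim b l =
    (1 - (if l <= b then 1 else 0)) * (k * trim b l)
    + (if r < c then 1 else 0) * (if l <= b then 1 else 0)
    + (1 - (if r < c then 1 else 0)) * (k * trim c r).
Proof.
move=> k1 k0.
have t1 u v : v <= u -> trim u v = 1 by rewrite /trim leNgt => /negbTE ->.
case: (leP l b) => lb; case: (ltP r c) => rc.
- by rewrite (t1 _ _ (ltW rc)) (t1 _ _ lb) k1; [ring|lra].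
- by rewrite (t1 _ _ lb); ring.
- by rewrite (t1 _ _ (ltW rc)); ring.
- by rewrite k0; [ring|lra].
Qed.

Lemma bdmeas_trim {d} {X : measurableType d} (u v : X -> R) :
  bdmeas u -> bdmeas v -> (forall x, 0 <= u x) -> bdmeas (fun x => trim (u x) (v x)).
Proof.
move=> bu bv u0; split; last first.
  by exists 1 => x; have /andP[? ?] := trim_bounds (v x) (u0 x); rewrite ger0_norm.
apply: measurable_fun_ifT => //.
  by apply: measurable_fun_ltr; [exact: bu.1|exact: bv.1].
apply: measurable_funM; first exact: bu.1.
exact: (measurableT_comp (measurable_powR (-1)) bv.1).
Qed.

Context {dS dT} {S : measurableType dS} {T : measurableType dT}.
Variables (nu : {finite_measure set S -> \bar R}) (eta : {finite_measure set T -> \bar R}).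
Local Notation mu := (finprod nu eta).

(** The least squares density is trimmed, and [B] consists of the columns that
are not overfull.  The overfull columns end up saturated, which accounts for the
first integral; a row of positive residual fills all of [B], and the other rows
end up saturated by columns of [B] alone, so each row has at least the cheaper of
the two in [B]. *)
Theorem maximal_density (c : S -> R) (b : T -> R) : bdmeas c -> bdmeas b ->
  (forall s, 0 <= c s) -> (forall t, 0 <= b t) ->
  exists k : S * T -> R, exists B : set T, [/\ density k, measurable B,
    forall s, row_marginal eta k s <= c s, forall t, col_marginal nu k t <= b t &
    \int[eta]_t (\1_(~` B) t * b t) + \int[nu]_s Num.min (fine (eta B)) (c s)
      <= \int[mu]_z k z].
Proof.
move=> bc bb c0 b0.
have [k dk kopt] := least_squares_density nu eta bc bb.
have bk := density_bdmeas dk.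
have k0 z : 0 <= k z by have /andP[] := dk.2 z.
have brow := bdmeas_row nu eta bk; have bcol := bdmeas_col nu eta bk.
set r := row_marginal eta k in kopt brow *.
set l := col_marginal nu k in kopt bcol *.
have r0 s : 0 <= r s by apply: Rint_ge0.
have l0 t : 0 <= l t by apply: Rint_ge0.
pose gS s := trim (c s) (r s); pose gT t := trim (b t) (l t).
have bgS : bdmeas gS by exact: bdmeas_trim.
have bgT : bdmeas gT by exact: bdmeas_trim.
have gS01 s : 0 <= gS s <= 1 by exact: trim_bounds.
have gT01 t : 0 <= gT t <= 1 by exact: trim_bounds.
pose k' z := k z * gS z.1 * gT z.2.
have bk1 : bdmeas (fun z : S * T => k z * gS z.1) by exact: bdmeasM bk (bdmeas_fst bgS).
have bk2 : bdmeas (fun z : S * T => k z * gT z.2) by exact: bdmeasM bk (bdmeas_snd bgT).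
have bk' : bdmeas k' by exact: bdmeasM bk1 (bdmeas_snd bgT).
have row1 s : \int[eta]_t (k (s, t) * gS s) = Num.min (c s) (r s).
  by rewrite RintZr; [rewrite mulrC trim_mul|exact: bdmeas_pair2].
have col1 t : \int[nu]_s (k (s, t) * gT t) = Num.min (b t) (l t).
  by rewrite RintZr; [rewrite mulrC trim_mul|exact: bdmeas_pair1].
pose A := [set s | r s < c s]; pose B := [set t | l t <= b t].
have mA : measurable A.
  rewrite (_ : A = setT `&` (fun s => c s - r s) @^-1` `]0, +oo[).
    by have [mcr _] := bdmeasB bc brow; exact: mcr.
  by rewrite setTI; apply/seteqP; split => z; rewrite /A /= in_itv/= andbT subr_gt0.
have mB : measurable B.
  rewrite (_ : B = setT `&` (fun t => b t - l t) @^-1` `[0, +oo[).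
    by have [mcr _] := bdmeasB bb bcol; exact: mcr.
  by rewrite setTI; apply/seteqP; split => z; rewrite /B /= in_itv/= andbT subr_ge0.
have b1A : bdmeas (\1_A : S -> R) by exact: bdmeas_indic.
have b1B : bdmeas (\1_B : T -> R) by exact: bdmeas_indic.
have ind1 d (X : measurableType d) (D : set X) x : (\1_D x : R) = if `[<D x>] then 1 else 0.
  by rewrite indicE; case: asboolP => Dx; [rewrite mem_set|rewrite memNset].
exists k', B; split => //.
- split; first exact: bk'.1.
  move=> z; have /andP[? ?] := dk.2 z; have /andP[? ?] := gS01 z.1; have /andP[? ?] := gT01 z.2.
  have kg0 : 0 <= k z * gS z.1 by exact: mulr_ge0.
  rewrite /k' mulr_ge0//= mulr_ile1//; exact: mulr_ile1.
- move=> s; apply: (@le_trans _ _ (Num.min (c s) (r s))); last by rewrite ge_min lexx.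
  rewrite -row1; apply: le_Rint.
  + exact: bdmeas_pair2.
  + exact: (bdmeas_pair2 s bk1).
  by move=> t; rewrite ler_piMr ?mulr_ge0//=; [have /andP[] := gS01 s|have /andP[] := gT01 t].
- move=> t; apply: (@le_trans _ _ (Num.min (b t) (l t))); last by rewrite ge_min lexx.
  rewrite -col1; apply: le_Rint.
  + exact: bdmeas_pair1.
  + exact: (bdmeas_pair1 t bk2).
  move=> s; rewrite /k' mulrAC ler_piMr ?mulr_ge0//=; first by have /andP[] := gT01 t.
  by have /andP[] := gS01 s.
have b1nB : bdmeas (fun t => 1 - \1_B t : R) by apply: bdmeasB => //; exact: bdmeas_cst.
have b1nA : bdmeas (fun s => 1 - \1_A s : R) by apply: bdmeasB => //; exact: bdmeas_cst.
pose f1 (z : S * T) := (1 - \1_B z.2) * (k z * gT z.2).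
pose f2 (z : S * T) := \1_A z.1 * \1_B z.2 : R.
pose f3 (z : S * T) := (1 - \1_A z.1) * (k z * gS z.1).
have bf1 : bdmeas f1 by exact: bdmeasM (bdmeas_snd b1nB) bk2.
have bf2 : bdmeas f2 by exact: bdmeasM (bdmeas_fst b1A) (bdmeas_snd b1B).
have bf3 : bdmeas f3 by exact: bdmeasM (bdmeas_fst b1nA) bk1.
have E1 : \int[mu]_z f1 z = \int[eta]_t (\1_(~` B) t * b t).
  rewrite (Rint_col nu eta bf1); apply: eq_Rint => t.
  rewrite /col_marginal /f1 /= RintZl; last exact: (bdmeas_pair1 t bk2).
  rewrite col1 !ind1 asbool_neg; case: asboolP => tB /=; first by rewrite subrr !mul0r.
  by rewrite subr0 !mul1r min_l//; move/negP: tB; rewrite -ltNge; exact: ltW.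
have E2 : \int[mu]_z f2 z = \int[nu]_s (\1_A s * fine (eta B)).
  rewrite (Rint_row nu eta bf2); apply: eq_Rint => s.
  by rewrite /row_marginal /f2 /= RintZl// Rint_indicM.
have E3 : \int[mu]_z f3 z = \int[nu]_s ((1 - \1_A s) * c s).
  rewrite (Rint_row nu eta bf3); apply: eq_Rint => s.
  rewrite /row_marginal /f3 /= RintZl; last exact: (bdmeas_pair2 s bk1).
  rewrite row1 !ind1; case: asboolP => sA; first by rewrite subrr !mul0r.
  by rewrite subr0 !mul1r min_l//; move/negP: sA; rewrite -leNgt.
have key : \int[mu]_z (k' z - (f1 z + f2 z + f3 z)) = 0.
  apply: kopt; first by apply: bdmeasB => //; apply: bdmeasD => //; exact: bdmeasD.
  move=> z /= k1 k00; apply/eqP; rewrite subr_eq0; apply/eqP.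
  rewrite /k' /f1 /f2 /f3 !ind1.
  have -> : `[< A z.1 >] = (r z.1 < c z.1) by apply/asboolP/idP.
  have -> : `[< B z.2 >] = (l z.2 <= b z.2) by apply/asboolP/idP.
  exact: trim_split.
move: key; rewrite RintB//; last by apply: bdmeasD => //; exact: bdmeasD.
move=> /eqP; rewrite subr_eq0 => /eqP ->.
rewrite RintD//; last exact: bdmeasD.
rewrite RintD// E1 E2 E3 -addrA lerD2l -RintD; [|exact: bdmeasM (bdmeas_cst _)|exact: bdmeasM].
apply: le_Rint.
- by apply: bdmeas_min => //; exact: bdmeas_cst.
- by apply: bdmeasD; apply: bdmeasM => //; exact: bdmeas_cst.
move=> s; rewrite ind1; case: asboolP => _;
  by rewrite ?subrr ?subr0 ?mul0r ?mul1r ?addr0 ?add0r ge_min lexx ?orbT.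
Qed.

End trimming.

(** * From densities to sets *)

Section bang_bang.
Context {R : realType} {dS dT} {S : measurableType dS} {T : measurableType dT}.
Variables (nu : {finite_measure set S -> \bar R}) (eta : {finite_measure set T -> \bar R}).

(** [V] is, up to the factor [\int D], the integral of [D (y - mean y)^2]. *)
Lemma weighted_variance (D y : T -> R) : bdmeas D -> bdmeas y -> (forall t, 0 <= D t) ->
  (forall r, eta (y @^-1` [set r]) = 0%E) ->
  let V := (\int[eta]_t (D t * y t ^+ 2)) * (\int[eta]_t D t)
           - (\int[eta]_t (D t * y t)) ^+ 2 in
  0 <= V /\ (V = 0 -> \int[eta]_t D t = 0).
Proof.
move=> bD bdy D0 ynull V.
have bDy := bdmeasM bD bdy; have bDy2 := bdmeasM bD (bdmeasX 2 bdy).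
have [E0|E0] := eqVneq (\int[eta]_t D t) 0.
  split=> [|_]; last exact: E0.
  rewrite /V E0 mulr0 (_ : Rintegral _ _ _ = 0) ?expr0n/= ?subr0//.
  apply: (Rint_eq0_transfer (m := eta) (f := D) (Z := set0)) => //.
  by move=> t _ ->; rewrite mul0r.
set E := \int[eta]_t D t in V E0 *.
have E_gt0 : 0 < E by rewrite lt_def E0; exact: Rint_ge0.
pose r := (\int[eta]_t (D t * y t)) / E.
have bc a : bdmeas (fun _ : T => a : R) by exact: bdmeas_cst.
have bf : bdmeas (fun t => D t * (y t - r) ^+ 2).
  by apply: bdmeasM => //; apply/bdmeasX/bdmeasB.
have VE : V = E * \int[eta]_t (D t * (y t - r) ^+ 2).
  rewrite (@eq_Rint _ _ _ _ _
    (fun t => D t * y t ^+ 2 - (2 * r) * (D t * y t) + r ^+ 2 * D t)); last first.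
    by move=> t; ring.
  rewrite RintD ?RintB ?RintZl//; try by do ?[apply: bdmeasB|apply: bdmeasM].
  by rewrite -/E /V /r; field.
split.
  rewrite VE mulr_ge0 ?(ltW E_gt0)//; apply: Rint_ge0 => t.
  by rewrite mulr_ge0// sqr_ge0.
rewrite VE => /eqP; rewrite mulf_eq0 (negbTE E0)/= => /eqP int0.
apply: (Rint_eq0_transfer (m := eta) (Z := y @^-1` [set r]) bf) => //.
- by move=> t; rewrite mulr_ge0// sqr_ge0.
- by rewrite -[_ @^-1` _]setTI; apply: bdy.1.
move=> t /= yr /eqP; rewrite mulf_eq0 sqrf_eq0 subr_eq0 => /orP[/eqP//|/eqP yr'].
by case: yr.
Qed.

(** Exchanging the order of integration changes the sign. *)
Lemma Rint_antisym (G : S * S -> R) : bdmeas G ->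
  (forall s s', G (s', s) = - G (s, s')) -> \int[nu]_s \int[nu]_s' G (s, s') = 0.
Proof.
move=> bG GN; apply/eqP; rewrite -[_ == 0](@mulrn_eq0 R _ 2)/= mulr2n.
rewrite {1}Rint_swap//.
have -> : \int[nu]_s' \int[nu]_s G (s, s') = - \int[nu]_s' \int[nu]_s G (s', s).
  rewrite -RintN; last exact: bdmeas_Rint2.
  apply: eq_Rint => s'; rewrite -RintN; last exact: bdmeas_pair2.
  by apply: eq_Rint => s; exact: GN.
by rewrite addNr.
Qed.

Variables (x : S -> R) (y : T -> R).
Hypotheses (bx : bdmeas x) (bdy : bdmeas y).
Hypothesis xnull : forall r, nu (x @^-1` [set r]) = 0%E.
Hypothesis ynull : forall r, eta (y @^-1` [set r]) = 0%E.
Local Notation mu := (finprod nu eta).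

Section swap.
Variable a : S * T -> R.
Hypotheses (ba : bdmeas a) (a0 : forall z, 0 <= a z).

Let bD : bdmeas (fun p : (S * S) * T => a (p.1.1, p.2) * a (p.1.2, p.2)).
Proof.
apply: bdmeasM; apply: bdmeas_comp => //; apply: measurable_fun_pair => //;
  exact: (measurableT_comp _ measurable_fst).
Qed.

Let byD n : bdmeas (fun p : (S * S) * T => a (p.1.1, p.2) * a (p.1.2, p.2) * y p.2 ^+ n).
Proof.
apply: bdmeasM => //; apply: bdmeasX; apply: bdmeas_comp => //; exact: measurable_snd.
Qed.

Let Y n (p : S * S) := \int[eta]_t (a (p.1, t) * a (p.2, t) * y t ^+ n).

Let bY n : bdmeas (Y n).
Proof. exact: (bdmeas_Rint2 (finprod nu nu) eta (byD n)). Qed.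

Let YC n s s' : Y n (s', s) = Y n (s, s').
Proof. by apply: eq_Rint => t /=; rewrite [a _ * a _]mulrC. Qed.

Let V (p : S * S) := Y 2 p * Y 0 p - Y 1 p ^+ 2.

Let bV : bdmeas V.
Proof. by apply: bdmeasB; [exact: bdmeasM|exact: bdmeasX]. Qed.

Let VC s s' : V (s', s) = V (s, s').
Proof. by rewrite /V !(YC _ s). Qed.

Let pair_slice p : bdmeas (fun t => a (p.1, t) * a (p.2, t)).
Proof. by apply: bdmeasM; exact: bdmeas_pair2. Qed.

Let Y0E p : Y 0 p = \int[eta]_t (a (p.1, t) * a (p.2, t)).
Proof. by apply: eq_Rint => t; rewrite expr0 mulr1. Qed.

Let Y1E p : Y 1 p = \int[eta]_t (a (p.1, t) * a (p.2, t) * y t).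
Proof. by []. Qed.

Let V_variance p : 0 <= V p /\ (V p = 0 -> Y 0 p = 0).
Proof.
rewrite /V Y0E Y1E.
by apply: (weighted_variance (pair_slice p) bdy _ ynull) => t; rewrite mulr_ge0.
Qed.

Let H (z : S * T) := \int[nu]_s' ((x z.1 - x s') *
  (a (s', z.2) * (y z.2 * Y 0 (z.1, s') - Y 1 (z.1, s')))).

Let bHint : bdmeas (fun p : (S * T) * S => (x p.1.1 - x p.2) *
  (a (p.2, p.1.2) * (y p.1.2 * Y 0 (p.1.1, p.2) - Y 1 (p.1.1, p.2)))).
Proof.
have m11 : measurable_fun [set: (S * T) * S] (fun p => p.1.1).
  exact: (measurableT_comp measurable_fst measurable_fst).
have m12 : measurable_fun [set: (S * T) * S] (fun p => p.1.2).
  exact: (measurableT_comp measurable_snd measurable_fst).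
have m2 : measurable_fun [set: (S * T) * S] (fun p => p.2) by exact: measurable_snd.
have bYp n : bdmeas (fun p : (S * T) * S => Y n (p.1.1, p.2)).
  by apply: (bdmeas_comp (h := Y n)); [exact: measurable_fun_pair|exact: bY].
apply: bdmeasM; first by apply: bdmeasB; apply: bdmeas_comp.
apply: bdmeasM.
  by apply: bdmeas_comp => //; exact: measurable_fun_pair.
by apply: bdmeasB => //; apply: bdmeasM => //; apply: bdmeas_comp.
Qed.

Let bH : bdmeas H.
Proof. exact: (bdmeas_Rint2 mu nu bHint). Qed.

Let h z := a z * H z.

Let bh : bdmeas h. Proof. exact: bdmeasM. Qed.

(** For two rows [s] and [s'], a function of [t] that lives where both rows
of [a] do, has integral zero, and correlates nonnegatively with [y]: the
integral of [y * balanced] is the variance [V].  Adding [x s - x s'] times it to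
row [s] and subtracting the same from row [s'] exchanges mass between corners
of rectangles, towards pairing large [x] with large [y]. *)
Let balanced s s' t := a (s, t) * a (s', t) * (y t * Y 0 (s, s') - Y 1 (s, s')).

Let hE s t : h (s, t) = \int[nu]_s' ((x s - x s') * balanced s s' t).
Proof.
rewrite /h /H -RintZl; last exact: (bdmeas_pair2 (s, t) bHint).
by apply: eq_Rint => s' /=; rewrite /balanced; ring.
Qed.

Let balanced_fst s : bdmeas (fun p : S * T => (x s - x p.1) * balanced s p.1 p.2).
Proof.
have bYp n : bdmeas (fun p : S * T => Y n (s, p.1)).
  apply: (bdmeas_comp (h := fun s' => Y n (s, s'))); first exact: measurable_fst.
  exact: (bdmeas_pair2 s (bY n)).
have mst : bdmeas (fun p : S * T => a (s, p.2)).
  apply: (bdmeas_comp (h := fun t => a (s, t))); first exact: measurable_snd.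
  exact: (bdmeas_pair2 s ba).
apply: bdmeasM.
  by apply: bdmeasB; [exact: bdmeas_cst|exact: bdmeas_fst].
apply: bdmeasM.
  apply: bdmeasM => //.
  by rewrite (_ : (fun p => _) = a)//; apply/funext => -[].
by apply: bdmeasB => //; apply: bdmeasM => //; exact: bdmeas_snd.
Qed.

Let balanced_slice t : bdmeas (fun p : S * S => balanced p.1 p.2 t).
Proof.
have ba1 : bdmeas (fun p : S * S => a (p.1, t)).
  apply: (bdmeas_comp (h := fun s => a (s, t))); first exact: measurable_fst.
  exact: bdmeas_pair1.
have ba2 : bdmeas (fun p : S * S => a (p.2, t)).
  apply: (bdmeas_comp (h := fun s => a (s, t))); first exact: measurable_snd.
  exact: bdmeas_pair1.
have bY' n : bdmeas (fun p : S * S => Y n (p.1, p.2)).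
  by rewrite (_ : (fun p => _) = Y n)//; apply/funext => -[].
apply: bdmeasM; first exact: bdmeasM.
by apply: bdmeasB => //; apply: bdmeasM => //; exact: bdmeas_cst.
Qed.

Let bxx : bdmeas (fun p : S * S => x p.1 - x p.2).
Proof. by apply: bdmeasB; [exact: bdmeas_fst|exact: bdmeas_snd]. Qed.

Let h_col t : col_marginal nu h t = 0.
Proof.
rewrite /col_marginal (@eq_Rint _ _ _ nu _ _ (fun s => hE s t)).
apply: (Rint_antisym (G := fun p => (x p.1 - x p.2) * balanced p.1 p.2 t)).
  exact: bdmeasM.
move=> s s' /=; rewrite /balanced !(YC _ s s') [a (s', t) * _]mulrC; ring.
Qed.

Let h_row s : row_marginal eta h s = 0.
Proof.
rewrite /row_marginal (@eq_Rint _ _ _ eta _ _ (fun t => hE s t)).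
rewrite -(Rint_swap nu eta (balanced_fst s))/=.
rewrite (@eq_Rint _ _ _ nu _ (fun _ => 0)); first by rewrite Rint_cst mul0r.
move=> s' /=.
have b1 := pair_slice (s, s'); have b2 := bdmeasM b1 bdy.
have bcst r : bdmeas (fun _ : T => r : R) by exact: bdmeas_cst.
rewrite (@eq_Rint _ _ _ eta _ (fun t => (x s - x s') *
  (a (s, t) * a (s', t) * y t * Y 0 (s, s') - a (s, t) * a (s', t) * Y 1 (s, s')))); last first.
  by move=> t; rewrite /balanced; ring.
rewrite RintZl; last by apply: bdmeasB; apply: bdmeasM.
rewrite RintB; [|exact: bdmeasM|exact: bdmeasM].
by rewrite RintZr// RintZr// -(Y1E (s, s')) -(Y0E (s, s')) [_ * Y 1 _]mulrC subrr mulr0.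
Qed.

Let yh_row s : \int[eta]_t (y t * h (s, t)) = \int[nu]_s' ((x s - x s') * V (s, s')).
Proof.
have bF : bdmeas (fun p : S * T => y p.2 * ((x s - x p.1) * balanced s p.1 p.2)).
  by apply: bdmeasM => //; exact: bdmeas_snd.
rewrite (@eq_Rint _ _ _ eta _
    (fun t => \int[nu]_s' (y t * ((x s - x s') * balanced s s' t)))); last first.
  by move=> t; rewrite hE RintZl//; exact: (bdmeas_pair1 t (balanced_fst s)).
rewrite -(Rint_swap nu eta bF)/=; apply: eq_Rint => s'.
have b1 := pair_slice (s, s'); have b2 := bdmeasM b1 bdy.
have b3 := bdmeasM b1 (bdmeasX 2 bdy).
have bcst r : bdmeas (fun _ : T => r : R) by exact: bdmeas_cst.
rewrite (@eq_Rint _ _ _ eta _ (fun t => (x s - x s') *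
  (a (s, t) * a (s', t) * y t ^+ 2 * Y 0 (s, s')
    - a (s, t) * a (s', t) * y t * Y 1 (s, s')))); last first.
  by move=> t; rewrite /balanced; ring.
rewrite RintZl; last by apply: bdmeasB; apply: bdmeasM.
rewrite RintB; [|exact: bdmeasM|exact: bdmeasM].
by rewrite RintZr// RintZr.
Qed.

Let wh_int : \int[mu]_z (x z.1 * y z.2 * h z) =
  2^-1 * \int[nu]_s \int[nu]_s' ((x s - x s') ^+ 2 * V (s, s')).
Proof.
have bF : bdmeas (fun z => x z.1 * y z.2 * h z).
  by apply: bdmeasM => //; apply: bdmeasM; [exact: bdmeas_fst|exact: bdmeas_snd].
have bx1 : bdmeas (fun p : S * S => x p.1) by exact: bdmeas_fst.
have b1 : bdmeas (fun p => x p.1 * ((x p.1 - x p.2) * V p)).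
  by apply: bdmeasM => //; exact: bdmeasM.
have b2 : bdmeas (fun p => 2^-1 * ((x p.1 - x p.2) ^+ 2 * V p)).
  by apply: bdmeasM; [exact: bdmeas_cst|apply: bdmeasM => //; exact: bdmeasX].
rewrite (Rint_row nu eta bF).
rewrite (@eq_Rint _ _ _ nu _
    (fun s => \int[nu]_s' (x s * ((x s - x s') * V (s, s'))))); last first.
  move=> s; rewrite RintZl; last first.
    exact: (bdmeas_pair2 s (bdmeasM bxx bV)).
  rewrite -yh_row -RintZl; last first.
    by apply: bdmeasM => //; exact: bdmeas_pair2.
  by apply: eq_Rint => t; rewrite mulrA.
rewrite -RintZl; last first.
  apply: (bdmeas_Rint2 nu nu (F := fun p => (x p.1 - x p.2) ^+ 2 * V p)).
  by apply: bdmeasM => //; exact: bdmeasX.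
rewrite [RHS](@eq_Rint _ _ _ nu _
    (fun s => \int[nu]_s' (2^-1 * ((x s - x s') ^+ 2 * V (s, s'))))); last first.
  move=> s; rewrite RintZl//.
  apply: (bdmeas_pair2 s (F := fun p => (x p.1 - x p.2) ^+ 2 * V p)).
  by apply: bdmeasM => //; exact: bdmeasX.
apply/eqP; rewrite -subr_eq0 -RintB;
  [|exact: (bdmeas_Rint2 nu nu b1)|exact: (bdmeas_Rint2 nu nu b2)].
rewrite (@eq_Rint _ _ _ nu _ (fun s =>
  \int[nu]_s' (x s * ((x s - x s') * V (s, s'))
    - 2^-1 * ((x s - x s') ^+ 2 * V (s, s'))))); last first.
  by move=> s; rewrite RintB//; [exact: (bdmeas_pair2 s b1)|exact: (bdmeas_pair2 s b2)].
rewrite (Rint_antisym (bdmeasB b1 b2))// => s s' /=.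
by rewrite (VC s s'); field.
Qed.

(** [a * H] averages the exchanges between row [s] and all the other rows.  It
keeps all marginals, and its pairing with [x(s) y(t)] is half the integral of
[(x s - x s')^2 V(s, s')].  If this is not positive, then [V] vanishes for
almost all pairs of rows, as the fibres of [x] are null; as the fibres of [y] are
null, [a(s, t) a(s', t)] then vanishes almost everywhere, and integrating it over
[s] and [s'] gives the squares of the column integrals of [a]. *)
Lemma swap_direction : exists H : S * T -> R, [/\ bdmeas H,
  forall s, row_marginal eta (fun z => a z * H z) s = 0,
  forall t, col_marginal nu (fun z => a z * H z) t = 0 &
  \int[mu]_z (x z.1 * y z.2 * (a z * H z)) <= 0 -> \int[mu]_z a z = 0].
Proof.
exists H; split => //; rewrite wh_int => le0.
have bW : bdmeas (fun p => (x p.1 - x p.2) ^+ 2 * V p).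
  by apply: bdmeasM => //; exact: bdmeasX.
have W0 p : 0 <= (x p.1 - x p.2) ^+ 2 * V p.
  by rewrite mulr_ge0 ?sqr_ge0//; have [] := V_variance p.
have int0 : \int[nu]_s \int[nu]_s' ((x s - x s') ^+ 2 * V (s, s')) = 0.
  apply/eqP; rewrite eq_le -(pmulr_rle0 _ (_ : 0 < 2^-1)) ?invr_gt0// le0/=.
  by apply: Rint_ge0 => s; apply: Rint_ge0 => s'; exact: (W0 (s, s')).
have Y0int : \int[nu]_s \int[nu]_s' Y 0 (s, s') = 0.
  apply: (Rint_eq0_transfer (Z := set0) (bdmeas_Rint2 nu nu bW) (bdmeas_Rint2 nu nu (bY 0))) => //.
    by move=> s; apply: Rint_ge0 => s'; exact: (W0 (s, s')).
  move=> s _ s0.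
  apply: (Rint_eq0_transfer (Z := x @^-1` [set x s])
    (bdmeas_pair2 s bW) (bdmeas_pair2 s (bY 0))) => //.
    by rewrite -[_ @^-1` _]setTI; apply: bx.1.
  move=> s' /= xs /eqP; rewrite mulf_eq0 sqrf_eq0 subr_eq0 => /orP[/eqP xs'|/eqP V0].
    by case: xs.
  by have [_ ->] := V_variance (s, s').
pose al t := \int[nu]_s a (s, t).
have bal : bdmeas al by exact: bdmeas_Rint1.
have alsq : \int[eta]_t al t ^+ 2 = 0.
  rewrite -Y0int.
  rewrite (@eq_Rint _ _ _ nu _ (fun s => \int[eta]_t (a (s, t) * al t))); last first.
    move=> s.
    rewrite (@eq_Rint _ _ _ nu _ (fun s' => \int[eta]_t (a (s, t) * a (s', t)))); last first.
      by move=> s'; rewrite Y0E.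
    have bas : bdmeas (fun p : S * T => a (s, p.2) * a (p.1, p.2)).
      apply: bdmeasM.
        apply: (bdmeas_comp (h := fun t => a (s, t))); first exact: measurable_snd.
        exact: bdmeas_pair2.
      by rewrite (_ : (fun p => _) = a)//; apply/funext => -[].
    rewrite (Rint_swap nu eta bas); apply: eq_Rint => t /=.
    by rewrite RintZl//; exact: bdmeas_pair1.
  have baal : bdmeas (fun p : S * T => a p * al p.2).
    by apply: bdmeasM => //; exact: bdmeas_snd.
  rewrite (Rint_swap nu eta baal); apply: eq_Rint => t /=.
  by rewrite RintZr ?expr2//; exact: bdmeas_pair1.
rewrite (Rint_col nu eta ba).
apply: (Rint_eq0_transfer (Z := set0) (bdmeasX 2 bal) bal) => //.
  by move=> t; exact: sqr_ge0.
by move=> t _ /eqP; rewrite sqrf_eq0 => /eqP.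
Qed.

End swap.

End bang_bang.

Section set_with_marginals.
Context {R : realType} {dS dT} {S : measurableType dS} {T : measurableType dT}.
Variables (nu : {finite_measure set S -> \bar R}) (eta : {finite_measure set T -> \bar R}).
Local Notation mu := (finprod nu eta).

Lemma density_indic (F : set (S * T)) : measurable F -> density (\1_F : S * T -> R).
Proof.
move=> mF; split; first exact: measurable_indic.
by move=> z; rewrite indicE; case: (_ \in _); rewrite !lexx ler01.
Qed.

(** The maximizer [k] of the integral of [x(s) y(t) k] is perturbed along
[swap_direction] for [a = k (1 - k)], a weight that bounds the distance from
[k] to both 0 and 1.  Hence [a] has integral zero; the set is a superlevel set
of [k], and [2 a] dominates the distance between [k] and its indicator.
Prescribing the marginals is itself a constraint on [misfit]. *)
Lemma set_of_density (x : S -> R) (y : T -> R) :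
  bdmeas x -> bdmeas y ->
  (forall r, nu (x @^-1` [set r]) = 0%E) -> (forall r, eta (y @^-1` [set r]) = 0%E) ->
  forall k0 : S * T -> R, density k0 -> exists2 F : set (S * T), measurable F &
    misfit nu eta (row_marginal eta k0) (col_marginal nu k0) \1_F = 0.
Proof.
move=> bx bdy xnull ynull k0 dk0.
have bk0 := density_bdmeas dk0.
have brow := bdmeas_row nu eta bk0; have bcol := bdmeas_col nu eta bk0.
set Psi := misfit nu eta (row_marginal eta k0) (col_marginal nu k0).
have lPsi : L1lipschitz mu Psi := misfit_L1lipschitz nu eta brow bcol.
pose w (z : S * T) := x z.1 * y z.2.
have bw : bdmeas w by apply: bdmeasM; [exact: bdmeas_fst|exact: bdmeas_snd].
have bwk k : density k -> bdmeas (fun z => w z * k z).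
  by move=> /density_bdmeas bk; exact: bdmeasM.
pose Phi k := - \int[mu]_z (w z * k z).
have [_ [W wW]] := bw.
have cPhi : midconvex Phi.
  move=> f g df dg; rewrite /Phi -opprD mulNr lerN2.
  rewrite -RintD; [|exact: bwk|exact: bwk].
  rewrite -RintZr; last by apply: bdmeasD; exact: bwk.
  rewrite le_eqVlt; apply/orP; left; apply/eqP.
  by apply: eq_Rint => z; rewrite /midpoint; ring.
have lPhi : L1lipschitz mu Phi.
  exists `|W| => // f g df dg; rewrite /Phi opprK addrC.
  have bfg := bdmeas_norm (bdmeasB (density_bdmeas df) (density_bdmeas dg)).
  rewrite -RintB; [|exact: bwk|exact: bwk].
  have bB := bdmeasB (bwk _ dg) (bwk _ df).
  rewrite (le_trans (le_norm_Rint _ bB))// -RintZl//; apply: le_Rint.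
  - exact: bdmeas_norm.
  - by apply: bdmeasM => //; exact: bdmeas_cst.
  move=> z; rewrite -mulrBr normrM [`|g z - _|]distrC ler_wpM2r//.
  by rewrite (le_trans (wW z))// ler_norm.
have Phi_lb : exists B, forall f, density f -> B <= Phi f.
  exists (- \int[mu]_z W) => f df; rewrite lerN2; apply: le_Rint.
  - exact: bwk.
  - exact: bdmeas_cst.
  move=> z; rewrite (le_trans (ler_norm _))// normrM.
  have /andP[f0 f1] := df.2 z; rewrite [`|f z|]ger0_norm//.
  by rewrite (le_trans _ (wW z))// ler_piMr.
have Psik0 : Psi k0 <= 0.
  rewrite /Psi /misfit (@eq_Rint _ _ _ nu _ (fun _ => 0)); last first.
    by move=> s; rewrite subrr expr0n.
  rewrite (@eq_Rint _ _ _ eta _ (fun _ => 0)); last first.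
    by move=> s; rewrite subrr expr0n.
  by rewrite !Rint_cst !mul0r addr0.
have [k [dk Psik kmin]] := direct_method (misfit_midconvex nu eta brow bcol) cPhi
  lPsi lPhi Phi_lb dk0 Psik0.
have bk := density_bdmeas dk.
pose a z := k z * (1 - k z).
have a0 z : 0 <= a z by have /andP[? ?] := dk.2 z; rewrite /a mulr_ge0// subr_ge0.
have ba : bdmeas a by apply: bdmeasM => //; apply: bdmeasB => //; exact: bdmeas_cst.
have [H [bH rowH colH inta]] := swap_direction bx bdy xnull ynull ba a0.
have bh := bdmeasM ba bH.
have [_ [M HM]] := bH.
have int_a : \int[mu]_z a z = 0.
  apply: inta.
    (* Small enough for [k + r * (a * H)] to remain a density. *)
pose r := (`|M| + 1)^-1.
  have r0 : 0 < r by rewrite invr_gt0 ltr_wpDl.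
  have rH z : `|r * H z| <= 1.
    rewrite normrM gtr0_norm// ler_pdivrMl ?ltr_wpDl// mulr1.
    by rewrite (le_trans (HM z))// (le_trans (ler_norm M))// lerDl.
  have dr : density (fun z => k z + r * (a z * H z)).
    split; first by have [] := bdmeasD bk (bdmeasM (bdmeas_cst r) bh).
    move=> z; have := rH z; rewrite ler_norml mulrCA => /andP[l1 l2].
    have ae1 : 0 <= a z * (1 + r * H z) by rewrite mulr_ge0//; lra.
    have ae2 : 0 <= a z * (1 - r * H z) by rewrite mulr_ge0//; lra.
    have := sqr_ge0 (k z); have := sqr_ge0 (1 - k z).
    by move: ae1 ae2; rewrite /a; set e := r * H z; lra.
  have Psir : Psi (fun z => k z + r * (a z * H z)) <= 0.
    apply: le_trans Psik; rewrite /Psi /misfit le_eqVlt; apply/orP; left; apply/eqP.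
    congr (_ + _); apply: eq_Rint.
      by move=> s; rewrite row_marginalDZ// rowH mulr0 addr0.
    by move=> t; rewrite col_marginalDZ// colH mulr0 addr0.
  have := kmin _ dr Psir; rewrite /Phi lerN2.
  rewrite (@eq_Rint _ _ _ mu _ (fun z => w z * k z + r * (w z * (a z * H z)))); last first.
    by move=> z; ring.
  have bwh : bdmeas (fun z => w z * (a z * H z)) by exact: bdmeasM.
  rewrite RintD//; [|exact: bwk|by apply: bdmeasM => //; exact: bdmeas_cst].
  by rewrite -lerBrDl subrr RintZl// pmulr_rle0.
pose F := [set z | 2^-1 < k z].
have mF : measurable F.
  rewrite (_ : F = setT `&` k @^-1` `]2^-1, +oo[); first exact: dk.1.
  by rewrite setTI; apply/seteqP; split => z; rewrite /F /= in_itv/= andbT.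
exists F => //.
have dF := density_indic mF.
have int_kF : \int[mu]_z `|\1_F z - k z| = 0.
  apply/eqP; rewrite eq_le Rint_ge0// andbT.
  rewrite -(mulr0 2) -int_a -RintZl//; apply: le_Rint.
  - by apply/bdmeas_norm/bdmeasB => //; exact: density_bdmeas.
  - by apply: bdmeasM => //; exact: bdmeas_cst.
  move=> z; have /andP[? ?] := dk.2 z; rewrite indicE.
  have [zF|zF] := pselect (F z).
    by rewrite mem_set// ger0_norm ?subr_ge0//= /a; move: zF; rewrite /F /=; nra.
  rewrite memNset//= sub0r normrN ger0_norm// /a.
  by move/negP: zF; rewrite -leNgt; nra.
have [K K0 lip] := lPsi.
have := lip _ _ dF dk; rewrite int_kF mulr0.
rewrite normr_le0 subr_eq0 => /eqP FK.
by apply/eqP; rewrite eq_le misfit_ge0 andbT -/Psi FK.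
Qed.

End set_with_marginals.

(** * Coordinates with null fibres on a standard measure space *)

Section ternary_code.
Context {R : realType} {d} {T : measurableType d}.
Variable E : nat -> set T.
Hypothesis mE : forall i, measurable (E i).

Let u (t : T) (i : nat) : R := 3^-1 ^+ i * \1_(E i) t.
Let s (t : T) (n : nat) : R := \sum_(0 <= i < n) u t i.

Let u_ge0 t i : 0 <= u t i.
Proof. by rewrite mulr_ge0// indicE; case: (_ \in _). Qed.

Let s_mono t n k : s t n <= s t (n + k).
Proof.
elim: k => [|k IH]; first by rewrite addn0.
by rewrite addnS /s big_nat_recr//= (le_trans IH)// lerDl.
Qed.

Let s_tail t n k :
  s t (n + k) <= s t n + 3 / 2 * (3^-1 ^+ n - 3^-1 ^+ (n + k)).
Proof.
elim: k => [|k IH]; first by rewrite addn0 subrr mulr0 addr0.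
rewrite addnS {1}/s big_nat_recr//= -/(s t (n + k)) exprS.
have : u t (n + k) <= 3^-1 ^+ (n + k).
  by rewrite /u ler_piMr// indicE; case: (_ \in _).
by move: IH; set a := 3^-1 ^+ (n + k); set b := 3^-1 ^+ n; lra.
Qed.

Let s_bounds t n m : s t m <= s t n + 3 / 2 * 3^-1 ^+ n.
Proof.
have p0 k : 0 <= (3^-1 : R) ^+ k by [].
have [mn|/ltnW nm] := leqP m n.
  by rewrite -(subnKC mn) (le_trans (s_mono t m (n - m)))// lerDl mulr_ge0.
rewrite -(subnKC nm) (le_trans (s_tail t n (m - n)))// lerD2l ler_wpM2l//.
by rewrite gerBl.
Qed.

(** The digits 0 and 1 in base 3 leave gaps, so that the sequence of digits can be
recovered from the sum. *)
Definition ternary_code (t : T) : R := limn (s t).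

Let s_cvg t : cvgn (s t).
Proof.
apply: nondecreasing_is_cvgn.
  by move=> n m nm; rewrite -(subnKC nm); exact: s_mono.
by exists (s t 0 + 3 / 2 * 3^-1 ^+ 0) => _ [m _ <-]; exact: s_bounds.
Qed.

Let code_ge t n : s t n <= ternary_code t.
Proof.
apply: limr_ge; first exact: s_cvg.
by exists n => // m /= nm; rewrite -(subnKC nm); exact: s_mono.
Qed.

Let code_le t n : ternary_code t <= s t n + 3 / 2 * 3^-1 ^+ n.
Proof.
apply: limr_le; first exact: s_cvg.
by apply: nearW => m; exact: s_bounds.
Qed.

Lemma bdmeas_ternary_code : bdmeas ternary_code.
Proof.
split; last first.
  exists (3 / 2) => t; rewrite ger0_norm; last first.
    by apply: le_trans (code_ge t 0); rewrite /s big_geq.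
  by have := code_le t 0; rewrite /s big_geq// expr0; lra.
apply: (@measurable_fun_cvg _ T R setT (fun n t => s t n)) => //.
  move=> n; apply: measurable_sum => i; apply: measurable_funM.
    exact: measurable_cst.
  exact: measurable_indic.
Qed.

Let separated t t' n : (forall i, (i < n)%N -> (t \in E i) = (t' \in E i)) ->
  t \in E n -> t' \notin E n -> ternary_code t' < ternary_code t.
Proof.
move=> eqE tE t'E.
have es : s t n = s t' n.
  by apply: eq_big_nat => i /andP[_ i_n]; rewrite /u !indicE eqE.
have h := code_ge t n.+1; have h' := code_le t' n.+1.
apply: le_lt_trans h' _; apply: lt_le_trans h.
rewrite /s !big_nat_recr//= -/(s t n) -/(s t' n) es /u !indicE tE (negbTE t'E).
rewrite mulr0 mulr1 addr0 ltrD2l exprS.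
by have : 0 < (3^-1 : R) ^+ n by []; lra.
Qed.

Lemma ternary_code_inj : (forall t t', (forall i, E i t <-> E i t') -> t = t') ->
  injective ternary_code.
Proof.
move=> sepE t t' tt'; apply: sepE => i0; apply: contrapT => Ei0.
have ex : exists i, (t \in E i) != (t' \in E i).
  exists i0; apply/eqP => e; apply: Ei0.
  by rewrite -(in_setE (E i0) t) -(in_setE (E i0) t') e.
case: (ex_minnP ex) => n nP nmin.
have eqE i : (i < n)%N -> (t \in E i) = (t' \in E i).
  by move=> i_n; apply/eqP; apply: contraTT i_n => /nmin; rewrite -leqNgt.
case tE : (t \in E n); case t'E : (t' \in E n); rewrite tE t'E// in nP.
  by have := separated eqE tE (negbT t'E); rewrite tt' ltxx.
have eqE' i (i_n : (i < n)%N) := esym (eqE i i_n).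
by have := separated eqE' t'E (negbT tE); rewrite tt' ltxx.
Qed.

End ternary_code.

Section standard_spaces.
Context {R : realType} {d} {T : measurableType d}.

(** Balls of radius [1/(m+1)] around a countable dense set separate points.  They
are indexed by an injection of the dense set into the integers, and the index
pair is encoded in one integer. *)
Lemma standard_borel_embedding : standard_borel R T ->
  exists x : T -> R, bdmeas x /\ injective x.
Proof.
move=> [X [f [[_ [D cD dD]] bf mf]]].
have [g ginj] := countable_injP _ cD.
have f_inj : injective f by exact: bij_inj.
pose U (n m : nat) : set X :=
  \bigcup_(z in [set z | D z /\ g z = n]) (ball z (m.+1%:R^-1 : R))°.
have oU n m : open (U n m) by apply: bigcup_open => z _; exact: open_interior.
pose E (i : nat) : set T :=
  if unpickle i is Some (n, m) then f @^-1` U n m else set0.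
have mE i : measurable (E i).
  rewrite /E; case: (unpickle i) => [[n m]|]; last exact: measurable0.
  by apply/mf; apply: sub_sigma_algebra; exact: oU.
exists (ternary_code E); split; first exact: bdmeas_ternary_code.
apply: ternary_code_inj => t t' EE; apply: contrapT => tt'.
have ft : f t != f t' by apply/eqP => /f_inj.
have d0 : 0 < mdist (f t) (f t') by rewrite mdist_gt0.
pose del := mdist (f t) (f t') / 2.
have del0 : 0 < del by rewrite divr_gt0.
(* Two points of one ball of radius [m.+1^-1] are closer to each other than
   [f t] and [f t'] are. *)
pose m := Num.truncn del^-1.
have me : (m.+1%:R^-1 : R) <= del.
  rewrite -[leRHS]invrK lef_pV2 ?posrE ?invr_gt0//.
  by apply: ltW; exact: truncnS_gt.
set e := (m.+1%:R^-1 : R) in me.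
have e0 : 0 < e by rewrite invr_gt0.
have [||z [zO Dz]] := dD (ball (f t) e)°; last 1 first.
- have zft : mdist z (f t) < e.
    by have := interior_subset zO; rewrite ballEmdist/= metric_sym.
  have Uft : U (g z) m (f t).
    exists z => //; apply/nbhs_ballP.
    exists (e - mdist z (f t)) => /=; first by rewrite subr_gt0.
    move=> y; rewrite !ballEmdist/= => fty.
    by rewrite (le_lt_trans (metric_triangle _ (f t) _))// addrC -ltrBrDr.
  have Eu v : E (pickle (g z, m)) v <-> U (g z) m (f v) by rewrite /E pickleK.
  have /Eu [z' [Dz' gz'] z't'] : E (pickle (g z, m)) t' by apply/EE/Eu.
  have zz' : z' = z by apply: ginj; rewrite ?inE.
  have zft' : mdist z (f t') < e.
    by have := interior_subset z't'; rewrite zz' ballEmdist.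
  have := metric_triangle (f t) z (f t'); rewrite (metric_sym (f t) z).
  by move: me zft zft'; rewrite /del; lra.
- by exists (f t); exact: nbhsx_ballx.
- exact: open_interior.
Qed.

(** Without atoms points are null, and the fibres of an injective coordinate
have at most one point. *)
Lemma standard_measure_coordinate (nu : {finite_measure set T -> \bar R}) :
  standard_measure_space nu ->
  exists2 x : T -> R, bdmeas x & forall r, nu (x @^-1` [set r]) = 0%E.
Proof.
move=> [/standard_borel_embedding[x [bx xinj]] atl]; exists x => // r.
have mF : measurable (x @^-1` [set r]).
  by rewrite -[_ @^-1` _]setTI; apply: bx.1.
apply/eqP; rewrite eq_le measure_ge0 andbT leNgt; apply/negP => F0.
have [B [mB BF /andP[B0 BltF]]] := atl _ mF F0.
have [B_ex|nB] := pselect (exists t, B t); last first.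
  move: B0; rewrite (_ : B = set0) ?measure0 ?ltxx//.
  by apply/seteqP; split => // t Bt; case: nB; exists t.
have [t Bt] := B_ex.
move: BltF; rewrite (_ : B = x @^-1` [set r]) ?ltxx//.
apply/seteqP; split => // t' /= xt'; have /= xt := BF _ Bt.
by rewrite (_ : t' = t)//; apply: xinj; rewrite xt'.
Qed.

End standard_spaces.

(** * The decreasing rearrangement *)

Lemma eq_indic {R : realType} {X Y : Type} (A : set X) (B : set Y) x y :
  (A x <-> B y) -> \1_A x = \1_B y :> R.
Proof.
move=> AB; rewrite !indicE.
by have [/[dup] Ax /AB By|/[dup] nAx] := pselect (A x);
  [rewrite !mem_set|rewrite AB => nBy; rewrite !memNset].
Qed.

Section layer_cake.
Context {R : realType} {d} {X : measurableType d}.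
Variable m : {sigma_finite_measure set X -> \bar R}.
Local Notation leb := (@lebesgue_measure R).

(** Tonelli on the region [0 <= s < f x]. *)
Lemma layer_cake (phi f : X -> R) : measurable_fun setT phi -> measurable_fun setT f ->
  (forall x, 0 <= phi x) -> (forall x, 0 <= f x) ->
  (\int[m]_x (phi x * f x)%:E =
   \int[leb]_(s in `[0%R, +oo[) \int[m]_x (phi x * \1_[set x | (s < f x)%R] x)%:E)%E.
Proof.
move=> mphi mf phi0 f0.
pose A : set (X * R) := [set z | 0 <= z.2 < f z.1].
have mA : measurable A.
  have m1 : measurable_fun [set: X * R] (fun z => 0 <= z.2).
    by apply: measurable_fun_ler => //; exact: measurable_cst.
  have m2 : measurable_fun [set: X * R] (fun z => z.2 < f z.1).
    by apply: measurable_fun_ltr => //; exact: measurableT_comp.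
  have /(_ measurableT [set true]) := measurable_and m1 m2.
  rewrite setTI (_ : _ @^-1` _ = A); first exact.
  by apply/seteqP; split => z.
have mF : measurable_fun [set: X * R] (fun z => (phi z.1 * \1_A z)%:E).
  apply/measurable_EFinP; apply: measurable_funM; last exact: measurable_indic.
  exact: measurableT_comp.
have F0 (z : X * R) : (0 <= (phi z.1 * \1_A z)%:E)%E.
  by rewrite lee_fin mulr_ge0.
have := fubini_tonelli (m1 := m) (m2 := leb) _ mF F0.
rewrite /= => E.
transitivity (\int[m]_x \int[leb]_s (phi x * \1_A (x, s))%:E)%E.
  apply: eq_integral => x _.
  have mAx : measurable_fun [set: R] (fun s => (\1_A (x, s) : R)%:E).
    apply/measurable_EFinP.
    have mI : measurable_fun [set: X * R] (\1_A : X * R -> R) by exact: measurable_indic.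
    exact: measurableT_comp mI (pair1_measurable x).
  under eq_integral do rewrite EFinM.
  rewrite ge0_integralZl// ?lee_fin//.
  rewrite (_ : (fun s => (\1_A (x, s))%:E) = (fun s => (\1_(`[0, f x[) s)%:E)).
    rewrite integral_indic// setIT/= lebesgue_measure_itv/= lte_fin.
    case: ltP => fx; first by rewrite sube0.
    by rewrite (le_anti _ : f x = 0) ?mulr0 ?mule0// fx f0.
  by apply/funext => s; congr _%:E; apply: eq_indic; rewrite /A /= in_itv.
rewrite E [RHS]integral_mkcond; apply: eq_integral => s _.
rewrite patchE; case: ifPn => s0.
  apply: eq_integral => x _; congr (_ * _)%:E; apply: eq_indic; rewrite /A /=.
  by move: s0; rewrite inE /= in_itv/= andbT => ->.
apply: integral0_eq => x _; rewrite indicE memNset ?mulr0// /A /= => /andP[s1 _].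
by move: s0; rewrite notin_setE; apply; rewrite /= in_itv/= s1.
Qed.

End layer_cake.

Section rearrangement_integral.
Context {R : realType} {d} {T : measurableType d}.
Variables (eta : {finite_measure set T -> \bar R}) (b : T -> R).
Hypotheses (bb : bdmeas b) (b0 : forall t, 0 <= b t).
Local Notation leb := (@lebesgue_measure R).
Local Notation tail s := (eta [set t | (s < b t)%R]).
Local Notation bstar := (rearrangement eta b).

Let mtail s : measurable [set t | s < b t].
Proof.
rewrite (_ : [set t | _] = setT `&` b @^-1` `]s, +oo[); first exact: bb.1.
by rewrite setTI; apply/seteqP; split => t /=; rewrite in_itv/= andbT.
Qed.

Let levels (u : R) := [set s : R | 0 <= s /\ (tail s <= u%:E)%E].

Let levels_nonempty u : 0 <= u -> levels u !=set0.
Proof.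
move=> u0; have [_ [M bM]] := bb; exists `|M|; split=> //.
rewrite (_ : [set t | _] = set0) ?measure0 ?lee_fin//.
apply/seteqP; split => // t /=; rewrite ltNge => /negP; apply.
by rewrite (le_trans (ler_norm _))// (le_trans (bM t))// ler_norm.
Qed.

Let levels_lb u : has_lbound (levels u).
Proof. by exists 0 => s []. Qed.

Lemma rearrangement_ge0 u : 0 <= u -> 0 <= bstar u.
Proof. by move=> u0; apply: lb_le_inf; [exact: levels_nonempty|move=> s []]. Qed.

Let tail_anti s s' : s <= s' -> (tail s' <= tail s)%E.
Proof.
move=> ss'; apply: le_measure; rewrite ?inE//.
by move=> t /= /(le_lt_trans ss').
Qed.

Let tail_rcont s u : (u%:E < tail s)%E -> exists2 s', s < s' & (u%:E < tail s')%E.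
Proof.
move=> us.
pose F n := [set t | s + n.+1%:R^-1 < b t].
have mF n : measurable (F n) by exact: mtail.
have FE : \bigcup_n F n = [set t | s < b t].
  apply/seteqP; split => [t [n _]|t /= st]; rewrite /F /=.
    by apply: le_lt_trans; rewrite lerDl.
  exists (Num.truncn (b t - s)^-1) => //=.
  rewrite addrC -ltrBrDr -[ltRHS]invrK ltf_pV2 ?posrE ?invr_gt0 ?subr_gt0//.
  exact: truncnS_gt.
have ndF : nondecreasing_seq F.
  move=> n p np; apply/subsetPset => t; rewrite /F /=; apply: le_lt_trans.
  by rewrite lerD2l lef_pV2 ?posrE// ler_nat ltnS.
have mU : measurable (\bigcup_n F n) by exact: bigcupT_measurable.
have := @nondecreasing_cvg_mu _ _ _ eta _ mF mU ndF; rewrite FE => cF.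
apply: contrapT => nex; move: us; apply/negP; rewrite -leNgt.
rewrite -(cvg_lim _ cF)//; apply: lime_le; first by apply/cvg_ex; eexists; exact: cF.
apply: nearW => n /=; rewrite leNgt; apply/negP => uF; apply: nex.
by exists (s + n.+1%:R^-1) => //; rewrite ltrDl.
Qed.

(** The rearrangement is the generalized inverse of the tail function; strict
inequalities correspond exactly because tails are right continuous. *)
Lemma lt_rearrangement s u : 0 <= s -> 0 <= u ->
  (s < bstar u) <-> (u%:E < tail s)%E.
Proof.
move=> s0 u0; split => [|].
  rewrite ltNge => /negP nle; rewrite ltNge; apply/negP => le; apply: nle.
  by apply: (ge_inf (levels_lb u)); split.
move=> /tail_rcont[s' ss' us']; apply: (lt_le_trans ss').
apply: lb_le_inf; first exact: levels_nonempty.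
move=> r [r0 tr]; rewrite leNgt; apply/negP => rs'.
by have := lt_le_trans us' (le_trans (tail_anti (ltW rs')) tr); rewrite ltxx.
Qed.

Let tail_fin s : tail s = (fine (tail s))%:E.
Proof. by rewrite fineK// fin_num_measure. Qed.

(** By [lt_rearrangement], the part of [[0, a]] where the rearrangement exceeds
[s] is an interval of length the minimum of [a] and the tail at [s]. *)
Lemma integral_rearrangement a : 0 <= a ->
  (\int[leb]_(u in `[0%R, a]) (bstar u)%:E =
   \int[leb]_(s in `[0%R, +oo[) mine a%:E (tail s))%E.
Proof.
move=> a0.
pose phi : R -> R := \1_(`[0, a]).
pose f : R -> R := bstar \_ `[0, a].
have mI : measurable_fun setT phi by exact: measurable_indic.
have f0 u : 0 <= f u.
  rewrite /f patchE; case: ifPn => // u_in; apply: rearrangement_ge0.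
  by move: u_in; rewrite inE/= in_itv/= => /andP[].
(* For [s < 0] the superlevel set is everything, as [f] is nonnegative. *)
have preim s : 0 <= s -> [set u | s < f u] = `[0, a] `&` `]-oo, fine (tail s)[%classic.
  move=> s0; apply/seteqP; split => u /=; rewrite /f patchE.
    case: ifPn => [|_ /lt_geF]; last by rewrite s0.
    rewrite inE /= => u_in sf; split => //; rewrite in_itv/=.
    rewrite in_itv/= in u_in; have /andP[u0 _] := u_in.
    by rewrite -lte_fin -tail_fin; apply/(lt_rearrangement s0 u0).
  move=> [u_in us]; rewrite mem_set//.
  move: u_in us; rewrite !in_itv/= => /andP[u0 _] us; apply/(lt_rearrangement s0 u0).
  by rewrite tail_fin lte_fin.
have mf : measurable_fun setT f.
  apply: (measurability _ (RGenOInfty.measurableE R)) => //.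
  move=> /= _ [_ [s ->] <-]; rewrite setTI.
  rewrite (_ : f @^-1` _ = [set u | s < f u]); last first.
    by apply/seteqP; split => u /=; rewrite in_itv/= andbT.
  have [s0|s0] := leP 0 s.
    by rewrite preim//; apply: measurableI; exact: measurable_itv.
  rewrite (_ : [set u | _] = setT)//; apply/seteqP; split => // u _ /=.
  exact: lt_le_trans (f0 u).
have phi0 u : 0 <= phi u by rewrite /phi indicE.
transitivity (\int[leb]_u (phi u * f u)%:E)%E.
  rewrite integral_mkcond; apply: eq_integral => u _.
  rewrite /f /phi !patchE indicE; case: ifPn => u_in; last by rewrite mulr0.
  by rewrite mul1r.
rewrite (layer_cake leb mI mf phi0 f0); apply: eq_integral => s.
rewrite inE/= in_itv/= andbT => s0.
transitivity (\int[leb]_u (\1_(`[0%R, a] `&` `]-oo, fine (tail s)[%classic) u : R)%:E)%E.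
  apply: eq_integral => u _; congr _%:E.
  rewrite preim// /phi !indicE in_setI.
  by case: (u \in `[0, a]%classic); rewrite /= ?mul1r ?mul0r.
rewrite integral_indic//; last by apply: measurableI; exact: measurable_itv.
rewrite setIT.
have t0 : 0 <= fine (tail s) by exact: fine_ge0.
rewrite [in RHS]tail_fin.
have [at_|ta] := ltP a (fine (tail s)).
  rewrite (_ : _ `&` _ = `[0, a]%classic).
    rewrite /= lebesgue_measure_itv/= lte_fin oppr0 adde0 min_l ?lee_fin ?(ltW at_)//.
    by case: ltP => // a0'; congr _%:E; apply/le_anti; rewrite a0 a0'.
  apply/seteqP; split => u /=; rewrite !in_itv/=; first by case.
  move=> /andP[u0 ua]; rewrite u0 ua; split=> //; exact: le_lt_trans at_.
rewrite (_ : _ `&` _ = `[0, fine (tail s)[%classic).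
  rewrite /= lebesgue_measure_itv/= lte_fin oppr0 adde0 min_r ?lee_fin//.
  by case: ltP => // t0'; congr _%:E; apply/le_anti; rewrite t0 t0'.
apply/seteqP; split => u /=; rewrite !in_itv/=; first by move=> [/andP[-> _] ->].
by move=> /andP[u0 ut]; rewrite u0 ut (le_trans (ltW ut) ta).
Qed.

Let measurable_weighted_tail (phi : T -> R) : measurable_fun setT phi -> (forall t, 0 <= phi t) ->
  measurable_fun [set: R] (fun s => \int[eta]_t (phi t * \1_[set t | (s < b t)%R] t)%:E)%E.
Proof.
move=> mphi phi0.
pose A : set (T * R) := [set z | z.2 < b z.1].
have mA : measurable A.
  have m2 : measurable_fun [set: T * R] (fun z => z.2 < b z.1).
    by apply: measurable_fun_ltr => //; exact: measurableT_comp bb.1 measurable_fst.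
  have /(_ measurableT [set true]) := m2.
  rewrite setTI (_ : _ @^-1` _ = A); first exact.
  by apply/seteqP; split => z.
have mF : measurable_fun [set: T * R] (fun z => (phi z.1 * \1_A z)%:E).
  apply/measurable_EFinP; apply: measurable_funM; last exact: measurable_indic.
  exact: measurableT_comp.
have F0 (z : T * R) : (0 <= (phi z.1 * \1_A z)%:E)%E by rewrite lee_fin mulr_ge0.
have := measurable_fun_fubini_tonelli_G (m1 := eta) _ mF F0.
by apply: eq_measurable_fun => s _; apply: eq_integral => t _.
Qed.

Let measurable_tail_min a : measurable_fun [set: R] (fun s => mine a%:E (tail s))%E.
Proof.
apply: measurable_mine; first exact: measurable_cst.
have m1 : measurable_fun [set: T] (fun _ : T => 1 : R) by exact: measurable_cst.
have := measurable_weighted_tail m1 (fun _ => ler01).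
apply: eq_measurable_fun => s _ /=.
under eq_integral do rewrite mul1r.
by rewrite integral_indic// setIT.
Qed.

Let weighted_tail_ge0 (phi : T -> R) s : (forall t, 0 <= phi t) ->
  (0 <= \int[eta]_t (phi t * \1_[set t | (s < b t)%R] t)%:E)%E.
Proof. by move=> phi0; apply: integral_ge0 => t _; rewrite lee_fin mulr_ge0. Qed.

Let tail_min_ge0 a s : 0 <= a -> (0 <= mine a%:E (tail s))%E.
Proof. by move=> a0; rewrite le_min lee_fin a0 measure_ge0. Qed.

(** Level by level, [B] meets [{ s < b }] in measure at most the minimum of the
two measures. *)
Lemma integral_le_rearrangement (B : set T) : measurable B ->
  ((\int[eta]_t (\1_B t * b t))%:E <=
    \int[leb]_(u in `[0%R, fine (eta B)]) (bstar u)%:E)%E.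
Proof.
move=> mB; have e0 : 0 <= fine (eta B) by exact: fine_ge0.
have mI : measurable_fun setT (\1_B : T -> R) by exact: measurable_indic.
have I0 t : 0 <= (\1_B t : R) by [].
rewrite EFin_Rint; last first.
  by apply: bdmeasM => //; exact: bdmeas_indic.
rewrite (layer_cake eta mI bb.1 I0 b0) integral_rearrangement//.
apply: ge0_le_integral => //.
- by move=> s _; exact: weighted_tail_ge0.
- by apply: measurable_funTS; exact: measurable_weighted_tail.
- by apply: measurable_funTS; exact: measurable_tail_min.
move=> s _; rewrite fineK ?fin_num_measure//.
have -> : (\int[eta]_t (\1_B t * \1_[set t | (s < b t)%R] t)%:E =
      eta (B `&` [set t | (s < b t)%R]))%E.
  under eq_integral do rewrite -[_ * _]/((\1_B \* \1__) _) -indicI.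
  by rewrite integral_indic ?setIT//; exact: measurableI.
by rewrite le_min !le_measure ?inE//; exact: measurableI.
Qed.

Let tail_left_limit l a : 0 < l -> (forall s, 0 <= s -> s < l -> (a%:E <= tail s)%E) ->
  (a%:E <= eta [set t | (l <= b t)%R])%E.
Proof.
move=> l0 h.
pose F n := [set t | l - l * n.+1%:R^-1 < b t].
have mF n : measurable (F n) by exact: mtail.
have FE : \bigcap_n F n = [set t | l <= b t].
  apply/seteqP; split => [t Ft|t /= lbt n _].
    rewrite /= leNgt; apply/negP => bl.
    have := Ft (Num.truncn ((l - b t) / l)^-1) Logic.I; rewrite /F /=.
    apply/negP; rewrite -leNgt lerBrDl -lerBrDr -ler_pdivlMl// mulrC.
    rewrite -[leRHS]invrK lef_pV2 ?posrE ?invr_gt0 ?divr_gt0 ?subr_gt0//.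
      by apply: ltW; exact: truncnS_gt.
    by rewrite mulr_gt0 ?invr_gt0 ?subr_gt0.
  by rewrite /F /= (lt_le_trans _ lbt)// ltrBlDr ltrDl mulr_gt0.
have niF : nonincreasing_seq F.
  move=> n p np; apply/subsetPset => t; rewrite /F /=; apply: le_lt_trans.
  by rewrite lerD2l lerN2 ler_pM2l// lef_pV2 ?posrE// ler_nat ltnS.
have F0 : (eta (F 0%N) < +oo)%E by rewrite ltey_eq fin_num_measure.
have mU : measurable (\bigcap_n F n) by exact: bigcapT_measurable.
have := @nonincreasing_cvg_mu _ _ _ eta _ F0 mF mU niF; rewrite FE => cF.
rewrite -(cvg_lim _ cF)//; apply: lime_ge; first by apply/cvg_ex; eexists; exact: cF.
apply: nearW => n /=; apply: h; last by rewrite ltrBlDr ltrDl mulr_gt0.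
by rewrite subr_ge0 ler_piMr ?(ltW l0)// invf_le1// ler1n.
Qed.

(** The weight is 1 above the quantile [l = bstar a], 0 below it, and a constant
[th] on the level set [b = l], with [th] chosen to bring the total weight to
[a]; when [l = 0] the total may stay below [a]. *)
Lemma rearrangement_weight a : 0 <= a -> exists phi : T -> R,
  [/\ density phi, \int[eta]_t phi t <= a &
    (\int[leb]_(u in `[0%R, a]) (bstar u)%:E <= (\int[eta]_t (phi t * b t))%:E)%E].
Proof.
move=> a0; pose l := bstar a.
have l0 : 0 <= l by exact: rearrangement_ge0.
pose E2 := [set t | b t = l].
have mE2 : measurable E2.
  rewrite (_ : E2 = setT `&` b @^-1` [set l]); first exact: bb.1.
  by rewrite setTI.
pose E1 := [set t | l < b t].
have mE1 : measurable E1 by exact: mtail.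
pose e1 := fine (eta E1); pose e2 := fine (eta E2).
have e1a : e1 <= a.
  rewrite -lee_fin fineK ?fin_num_measure// leNgt; apply/negP.
  by move=> /(lt_rearrangement l0 a0); rewrite ltxx.
have e20 : 0 <= e2 by exact: fine_ge0.
pose th := if e2 == 0 then 0 else Num.min 1 ((a - e1) / e2).
have th01 : 0 <= th <= 1.
  rewrite /th; case: eqP => [_|_]; first by rewrite lexx ler01.
  by rewrite le_min ler01 divr_ge0 ?subr_ge0//= ge_min lexx.
have the2 : th * e2 = Num.min e2 (a - e1).
  rewrite /th; case: eqP => [->|/eqP e2n].
    by rewrite mulr0 min_l// subr_ge0.
  by rewrite minr_pMl// mul1r divfK.
pose phi t := \1_E1 t + th * \1_E2 t : R.
have bI (E : set T) : measurable E -> bdmeas (\1_E : T -> R) := bdmeas_indic (A := E).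
have bphi : bdmeas phi.
  by apply: bdmeasD; [exact: bI|apply: bdmeasM; [exact: bdmeas_cst|exact: bI]].
have phiE t : phi t = if l < b t then 1 else if b t == l then th else 0.
  rewrite /phi !indicE; case: ltgtP => bl.
  - by rewrite mem_set// memNset ?mulr0 ?addr0// /E2 /= => e; rewrite e ltxx in bl.
  - rewrite memNset; last by rewrite /E1 /= ltNge ltW.
    by rewrite memNset ?mulr0 ?addr0// /E2 /= => e; rewrite e ltxx in bl.
  rewrite memNset; last by rewrite /E1 /= bl ltxx.
  by rewrite mem_set// add0r mulr1.
have dphi : density phi.
  split; first exact: bphi.1.
  move=> t; rewrite phiE; case: ifP => _; first by rewrite ler01 lexx.
  by case: ifP => // _; rewrite lexx ler01.
have phi0 t : 0 <= phi t by have /andP[] := dphi.2 t.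
have intphi : \int[eta]_t phi t = e1 + Num.min e2 (a - e1).
  rewrite RintD; [|exact: bI|by apply: bdmeasM; [exact: bdmeas_cst|exact: bI]].
  by rewrite RintZl; [rewrite !Rint_indicM// the2|exact: bI].
exists phi; split => //.
  by rewrite intphi -lerBrDl ge_min lexx orbT.
rewrite EFin_Rint; last exact: bdmeasM.
rewrite (layer_cake eta dphi.1 bb.1 phi0 b0) integral_rearrangement//.
apply: ge0_le_integral => //.
- by move=> s _; exact: tail_min_ge0.
- by apply: measurable_funTS; exact: measurable_tail_min.
- by apply: measurable_funTS; exact: (measurable_weighted_tail dphi.1).
move=> s; rewrite /= in_itv/= andbT => s0.
have [ls|sl] := leP l s.
  rewrite ge_min; apply/orP; right.
  rewrite (_ : tail s = \int[eta]_t (\1_[set t | (s < b t)%R] t)%:E)%E; last first.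
    by rewrite integral_indic// setIT.
  apply: ge0_le_integral => //.
  - by apply/measurable_EFinP; exact: measurable_indic.
  - apply/measurable_EFinP; apply: measurable_funM; first exact: dphi.1.
    exact: measurable_indic.
  move=> t _; rewrite lee_fin phiE indicE; case: (boolP (t \in _)); last by rewrite mulr0.
  by rewrite inE /= => /(le_lt_trans ls) ->; rewrite mul1r.
rewrite ge_min; apply/orP; left.
have -> : (\int[eta]_t (phi t * \1_[set t | (s < b t)%R] t)%:E = (\int[eta]_t phi t)%:E)%E.
  rewrite EFin_Rint//; apply: eq_integral => t _; congr _%:E.
  rewrite phiE indicE; case: ltgtP => bl; rewrite ?mul0r//.
    by rewrite mem_set ?mulr1//= (lt_trans sl).
  by rewrite mem_set ?mulr1//= -bl.
have lpos : 0 < l by exact: le_lt_trans sl.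
have : (a%:E <= eta [set t | (l <= b t)%R])%E.
  apply: tail_left_limit => // r r0 rl; apply: ltW.
  exact/(lt_rearrangement r0 a0).
rewrite (_ : [set t | _] = E1 `|` E2); last first.
  apply/seteqP; split => t; rewrite /E1 /E2 /= le_eqVlt.
    by move=> /orP[/eqP ->|->]; [right|left].
  by move=> [->|->]; rewrite ?eqxx ?orbT.
have E12 : E1 `&` E2 = set0.
  by apply/seteqP; split => // t [] /[swap]; rewrite /E1 /E2 /= => ->; rewrite ltxx.
have -> : eta (E1 `|` E2) = (e1 + e2)%:E.
  by rewrite EFinD !fineK ?fin_num_measure//; exact: measureU.
rewrite !lee_fin intphi => ae.
by rewrite -lerBlDl le_min lexx andbT lerBlDl.
Qed.

End rearrangement_integral.

(** * Duality *)

Section duality.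
Context {R : realType} {dS dT} {S : measurableType dS} {T : measurableType dT}.
Variables (nu : {finite_measure set S -> \bar R}) (eta : {finite_measure set T -> \bar R}).
Local Notation mu := (finprod nu eta).
Local Notation leb := (@lebesgue_measure R).

Lemma eta_xsection (F : set (S * T)) s : measurable F ->
  eta (xsection F s) = (row_marginal eta (\1_F : S * T -> R) s)%:E.
Proof.
move=> mF; rewrite /row_marginal EFin_Rint; last exact: (bdmeas_pair2 s (bdmeas_indic mF)).
transitivity (\int[eta]_t (\1_(xsection F s) t : R)%:E)%E.
  by rewrite integral_indic ?setIT//; exact: measurable_xsection.
apply: eq_integral => t _; congr _%:E; apply: eq_indic.
by split; rewrite /xsection /= inE.
Qed.

Lemma nu_ysection (F : set (S * T)) t : measurable F ->
  nu (ysection F t) = (col_marginal nu (\1_F : S * T -> R) t)%:E.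
Proof.
move=> mF; rewrite /col_marginal EFin_Rint; last exact: (bdmeas_pair1 t (bdmeas_indic mF)).
transitivity (\int[nu]_s (\1_(ysection F t) s : R)%:E)%E.
  by rewrite integral_indic ?setIT//; exact: measurable_ysection.
apply: eq_integral => s _; congr _%:E; apply: eq_indic.
by split; rewrite /ysection /= inE.
Qed.

Lemma prod_measureE (F : set (S * T)) : measurable F ->
  ((nu \x eta) F = (\int[mu]_z (\1_F z : R))%:E)%E.
Proof.
move=> mF; rewrite EFin_Rint; last exact: bdmeas_indic.
by rewrite integral_indic// setIT.
Qed.

Variables (b : T -> R) (c : S -> R).
Hypotheses (bb : bdmeas b) (bc : bdmeas c).
Hypotheses (b0 : forall t, 0 <= b t) (c0 : forall s, 0 <= c s).

Definition feasible (F : set (S * T)) := [/\ measurable F,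
  {ae eta, forall t, (nu (ysection F t) <= (b t)%:E)%E} &
  {ae nu, forall s, (eta (xsection F s) <= (c s)%:E)%E}].

Lemma integral_rearrangement_fin a : 0 <= a ->
  (\int[leb]_(u in `[0%R, a]) (rearrangement eta b u)%:E)%E \is a fin_num.
Proof.
move=> a0; have [phi [_ _ le]] := rearrangement_weight eta bb b0 a0.
rewrite ge0_fin_numE; first exact: le_lt_trans le (ltry _).
apply: integral_ge0 => u; rewrite /= in_itv/= => /andP[u0 _].
by rewrite lee_fin rearrangement_ge0.
Qed.

Lemma weak_duality F a : feasible F -> 0 <= a ->
  \int[mu]_z \1_F z + fine (\int[leb]_(u in `[0%R, a]) (rearrangement eta b u)%:E)%E
  <= \int[eta]_t b t + \int[nu]_s Num.min a (c s).
Proof.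
move=> [mF Fb Fc] a0.
have [phi [dphi phia Jphi]] := rearrangement_weight eta bb b0 a0.
have bphi := density_bdmeas dphi.
have bF : bdmeas (\1_F : S * T -> R) by exact: bdmeas_indic.
have phi01 t : 0 <= phi t <= 1 := dphi.2 t.
have bphi' : bdmeas (fun t => 1 - phi t) by apply: bdmeasB => //; exact: bdmeas_cst.
have b1 : bdmeas (fun z : S * T => phi z.2 * \1_F z).
  by exact: bdmeasM (bdmeas_snd bphi) bF.
have b2 : bdmeas (fun z : S * T => (1 - phi z.2) * \1_F z).
  by exact: bdmeasM (bdmeas_snd bphi') bF.
have F01 z : 0 <= (\1_F z : R) <= 1 := (density_indic mF).2 z.
have -> : \int[mu]_z \1_F z =
    \int[mu]_z (phi z.2 * \1_F z) + \int[mu]_z ((1 - phi z.2) * \1_F z).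
  by rewrite -RintD//; apply: eq_Rint => z; ring.
have i1 : \int[mu]_z (phi z.2 * \1_F z) <= \int[nu]_s Num.min a (c s).
  rewrite (Rint_row nu eta b1); apply: ae_le_Rint.
  - exact: bdmeas_row.
  - by apply: bdmeas_min => //; exact: bdmeas_cst.
  apply: filterS Fc => s; rewrite eta_xsection// lee_fin => Fcs.
  rewrite le_min; apply/andP; split.
    apply: le_trans phia; apply: le_Rint => //; first exact: (bdmeas_pair2 s b1).
    move=> t /=; have /andP[? ?] := phi01 t; have /andP[? ?] := F01 (s, t).
    by rewrite ler_piMr.
  apply: le_trans Fcs; apply: le_Rint; [exact: (bdmeas_pair2 s b1)|exact: (bdmeas_pair2 s bF)|].
  move=> t /=; have /andP[? ?] := phi01 t; have /andP[? ?] := F01 (s, t).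
  by rewrite ler_piMl.
have i2 : \int[mu]_z ((1 - phi z.2) * \1_F z) <= \int[eta]_t b t - \int[eta]_t (phi t * b t).
  rewrite -RintB//; last exact: bdmeasM.
  rewrite -(Rint_colM nu eta bphi' bF); apply: ae_le_Rint.
  - by apply: bdmeasM => //; exact: bdmeas_col.
  - by apply: bdmeasB => //; exact: bdmeasM.
  apply: filterS Fb => t; rewrite nu_ysection// lee_fin => Fbt.
  rewrite -[X in _ <= X - _]mul1r -mulrBl ler_wpM2l// subr_ge0.
  by have /andP[] := phi01 t.
have : fine (\int[leb]_(u in `[0%R, a]) (rearrangement eta b u)%:E)%E <= \int[eta]_t (phi t * b t).
  by rewrite -lee_fin fineK//; exact: integral_rearrangement_fin.
lra.
Qed.

(** The cut behind [maximal_density], with [a] the measure of [B]. *)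
Lemma strong_duality : standard_measure_space nu -> standard_measure_space eta ->
  exists F (a : R), [/\ feasible F, (0 <= a%:E <= eta setT)%E &
  \int[eta]_t b t + \int[nu]_s Num.min a (c s) <=
  \int[mu]_z \1_F z + fine (\int[leb]_(u in `[0%R, a]) (rearrangement eta b u)%:E)%E].
Proof.
move=> /standard_measure_coordinate[x bx xnull] /standard_measure_coordinate[y bdy ynull].
have [k [B [dk mB rowk colk kmass]]] := maximal_density nu eta bc bb c0 b0.
have bk := density_bdmeas dk.
have [F mF] := set_of_density bx bdy xnull ynull dk.
have bF : bdmeas (\1_F : S * T -> R) by exact: bdmeas_indic.
have bdr := bdmeasB (bdmeas_row nu eta bk) (bdmeas_row nu eta bF).
have bdc := bdmeasB (bdmeas_col nu eta bk) (bdmeas_col nu eta bF).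
rewrite /misfit => /eqP; rewrite paddr_eq0; last 2 first.
- by apply: Rint_ge0 => s; exact: sqr_ge0.
- by apply: Rint_ge0 => s; exact: sqr_ge0.
move=> /andP[/eqP r0 /eqP l0].
have aerow : {ae nu, forall s, row_marginal eta \1_F s = row_marginal eta k s}.
  have := Rint_eq0_ae (bdmeasX 2 bdr) (fun=> sqr_ge0 _) r0.
  by apply: filterS => s /eqP; rewrite sqrf_eq0 subr_eq0 => /eqP ->.
have aecol : {ae eta, forall t, col_marginal nu \1_F t = col_marginal nu k t}.
  have := Rint_eq0_ae (bdmeasX 2 bdc) (fun=> sqr_ge0 _) l0.
  by apply: filterS => s /eqP; rewrite sqrf_eq0 subr_eq0 => /eqP ->.
exists F, (fine (eta B)); split.
- split => //.
    by apply: filterS aecol => t e; rewrite nu_ysection// e lee_fin.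
  by apply: filterS aerow => s e; rewrite eta_xsection// e lee_fin.
- rewrite fineK ?fin_num_measure// measure_ge0/=.
  by apply: le_measure; rewrite ?inE.
have eB0 : 0 <= fine (eta B) by exact: fine_ge0.
have -> : \int[mu]_z \1_F z = \int[mu]_z k z.
  rewrite !Rint_row//; apply: ae_eq_Rint => //; exact: bdmeas_row.
have := integral_le_rearrangement eta bb b0 mB.
rewrite -[leRHS]fineK ?integral_rearrangement_fin// lee_fin => JB.
have bIB : bdmeas (\1_B : T -> R) by exact: bdmeas_indic.
have bICB : bdmeas (\1_(~` B) : T -> R) by apply: bdmeas_indic; exact: measurableC.
have : \int[eta]_t b t = \int[eta]_t (\1_B t * b t) + \int[eta]_t (\1_(~` B) t * b t).
  rewrite -RintD; [|exact: bdmeasM|exact: bdmeasM].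
  apply: eq_Rint => t; rewrite -mulrDl !indicE in_setC.
  by case: (_ \in _); rewrite /= ?addr0 ?add0r mul1r.
lra.
Qed.

End duality.

Section exact_marginals.
Context {R : realType} {dS dT} {S : measurableType dS} {T : measurableType dT}.
Variables (nu : {finite_measure set S -> \bar R}) (eta : {finite_measure set T -> \bar R}).
Local Notation mu := (finprod nu eta).
Variables (b : T -> R) (c : S -> R).
Hypotheses (bb : bdmeas b) (bc : bdmeas c).

Lemma exact_mass (F : set (S * T)) : measurable F ->
  {ae eta, forall t, nu (ysection F t) = (b t)%:E} ->
  {ae nu, forall s, eta (xsection F s) = (c s)%:E} ->
  \int[mu]_z \1_F z = \int[eta]_t b t /\ \int[mu]_z \1_F z = \int[nu]_s c s.
Proof.
move=> mF Fb Fc; have bF : bdmeas (\1_F : S * T -> R) by exact: bdmeas_indic.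
split.
  rewrite Rint_col//; apply: ae_eq_Rint => //; first exact: bdmeas_col.
  by apply: filterS Fb => t; rewrite nu_ysection// => -[].
rewrite Rint_row//; apply: ae_eq_Rint => //; first exact: bdmeas_row.
by apply: filterS Fc => s; rewrite eta_xsection// => -[].
Qed.

Lemma feasible_exact (F : set (S * T)) : feasible nu eta b c F ->
  \int[eta]_t b t <= \int[mu]_z \1_F z -> \int[nu]_s c s <= \int[mu]_z \1_F z ->
  {ae eta, forall t, nu (ysection F t) = (b t)%:E} /\
  {ae nu, forall s, eta (xsection F s) = (c s)%:E}.
Proof.
move=> [mF Fb Fc] bF cF; have bIF : bdmeas (\1_F : S * T -> R) by exact: bdmeas_indic.
split.
  rewrite Rint_col// in bF.
  have h := ae_eq_of_Rint_le (bdmeas_col nu eta bIF) bb _ bF.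
  apply: filterS (h _) => [t e|]; first by rewrite nu_ysection// -e.
  by apply: filterS Fb => t; rewrite nu_ysection.
rewrite Rint_row// in cF.
have h := ae_eq_of_Rint_le (bdmeas_row nu eta bIF) bc _ cF.
apply: filterS (h _) => [s e|]; first by rewrite eta_xsection// -e.
by apply: filterS Fc => t; rewrite eta_xsection.
Qed.

End exact_marginals.

Local Open Scope ereal_scope.
Theorem corollary7p13 (R : realType) (dS dT : measure_display)
    (S : measurableType dS) (T : measurableType dT)
    (nu : {finite_measure set S -> \bar R})
    (eta : {finite_measure set T -> \bar R})
    (hS : standard_measure_space nu) (hT : standard_measure_space eta)
    (b : T -> R) (c : S -> R)
    (mb : measurable_fun [set: T] b) (mc : measurable_fun [set: S] c)
    (hb : forall t : T, 0 <= (b t)%:E <= nu [set: S])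
    (hc : forall s : S, 0 <= (c s)%:E <= eta [set: T]) :
  let G (a : R) : \bar R :=
    \int[@lebesgue_measure R]_(u in `[0%R, a]) (rearrangement eta b u)%:E
    - \int[nu]_(s in [set: S]) (Num.min a (c s))%:E in
  let I : set R := [set a : R | 0 <= a%:E <= eta [set: T]] in
  (exists2 M : \bar R, is_max [set G a | a in I] M &
     max_measure nu eta b c = \int[eta]_(t in [set: T]) (b t)%:E - M)
  /\
  ((exists F : set (S * T),
      [/\ measurable F,
          {ae eta, forall t, nu (ysection F t) = (b t)%:E} &
          {ae nu, forall s, eta (xsection F s) = (c s)%:E}])
   <->
   (\int[eta]_(t in [set: T]) (b t)%:E = \int[nu]_(s in [set: S]) (c s)%:E
    /\ forall a : R, I a -> G a <= 0)).
Proof.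
move=> G I.
have b0 t : (0 <= b t)%R by have /andP[] := hb t.
have c0 s : (0 <= c s)%R by have /andP[] := hc s.
have bb : bdmeas b.
  split=> //; exists (fine (nu setT)) => t; rewrite ger0_norm//.
  by rewrite -lee_fin fineK ?fin_num_measure//; have /andP[] := hb t.
have bc : bdmeas c.
  split=> //; exists (fine (eta setT)) => s; rewrite ger0_norm//.
  by rewrite -lee_fin fineK ?fin_num_measure//; have /andP[] := hc s.
pose J a := fine (\int[@lebesgue_measure R]_(u in `[0%R, a]) (rearrangement eta b u)%:E).
pose K a : R := (\int[nu]_s Num.min a (c s))%R.
pose m F : R := (\int[finprod nu eta]_z \1_F z)%R.
have IntE : \int[eta]_t (b t)%:E = (\int[eta]_t b t)%R%:E by rewrite EFin_Rint.
have GE a : (0 <= a)%R -> G a = (J a - K a)%:E.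
  move=> a0; rewrite /G EFinB fineK ?integral_rearrangement_fin//.
  by rewrite EFin_Rint//; apply: bdmeas_min => //; exact: bdmeas_cst.
have I0 a : I a -> (0 <= a)%R by move=> /andP[].
have weak F a : feasible nu eta b c F -> I a ->
    (m F + J a <= \int[eta]_t b t + K a)%R.
  by move=> fF /I0 a0; exact: weak_duality.
have [F [a [fF Ia strong]]] := strong_duality bb bc b0 c0 hS hT.
rewrite -/(m F) -/(J a) -/(K a) in strong.
have mF : measurable F by have [] := fF.
have maxE : max_measure nu eta b c = (m F)%:E.
  apply/eqP; rewrite eq_le; apply/andP; split.
    apply: ge_ereal_sup => _ [F' fF' <-]; rewrite prod_measureE; last by have [] := fF'.
    by rewrite lee_fin -/(m F'); have := weak F' a fF' Ia; lra.
  by apply: ereal_sup_ubound; exists F => //; rewrite prod_measureE.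
split.
  exists (G a); last first.
    rewrite maxE IntE GE ?I0// -EFinB; congr EFin.
    by have := weak F a fF Ia; lra.
  split; first by exists a.
  move=> _ [a' Ia' <-]; rewrite !GE ?I0// lee_fin.
  by have := weak F a' fF Ia'; lra.
rewrite IntE -EFin_Rint//; split.
  move=> [F' [mF' Fb Fc]].
  have [eb ec] := exact_mass bb bc mF' Fb Fc.
  split; first by congr EFin; rewrite -eb.
  move=> a' Ia'; rewrite GE ?I0// lee_fin.
  have fF' : feasible nu eta b c F'.
    by split => //; [apply: filterS Fb => t ->|apply: filterS Fc => s ->].
  by have := weak F' a' fF' Ia'; rewrite /m eb; lra.
move=> [bcE G0]; exists F; have {}bcE := EFin_inj bcE.
have mFb : (\int[eta]_t b t <= m F)%R.
  by have := G0 a Ia; rewrite GE ?I0// lee_fin; lra.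
have mFc : (\int[nu]_s c s <= m F)%R by rewrite -bcE.
by have [Fb Fc] := feasible_exact bb bc fF mFb mFc; split.
Qed.
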